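(* Let $h>0$ and let $c(h),m(h)\in(0,\infty)$ be the constants of the lattice bound $\langle \sigma_x;\sigma_y\rangle_{a,h}\leq c(h)a^{1/4}|x-y|^{-1/4}e^{-m(h)|x-y|}$ valid for all $a\in(0,1]$ and $x\ne y\in a\mathbb{Z}^2$ (so that $m(h)\geq B_0h^{8/15}$ when $ha^{15/8}\le 1$). Then for all $f,g\in C_0^\infty(\mathbb{R}^2)$, \[\big|\mathrm{Cov}\big(\Phi^h(f),\Phi^h(g)\big)\big|\leq c(h)\int\!\!\int_{\mathbb{R}^2\times\mathbb{R}^2}|f(x)||g(y)|\,|x-y|^{-1/4}e^{-m(h)|x-y|}\,dx\,dy.\]
   Context: Let $\beta_c=\frac12\log(1+\sqrt2)$, and for $a>0,h\ge0$ let $P^a_h$ be the infinite-volume Ising measure on $a\mathbb{Z}^2$ at inverse temperature $\beta_c$ with external field $a^{15/8}h$, with expectation $\langle\cdot\rangle_{a,h}$ and truncated two-point function $\langle\sigma_x;\sigma_y\rangle_{a,h}$. The lattice magnetization field is $\Phi^{a,h}:=a^{15/8}\sum_{x\in a\mathbb{Z}^2}\sigma_x\delta_x$ with $\sigma\sim P^a_h$, so $\Phi^{a,h}(f)=a^{15/8}\sum_x\sigma_xf(x)$. It is known that $\Phi^{a,h}$ converges in law as $a\downarrow 0$ to a generalized random field $\Phi^h$ on $\mathbb{R}^2$ (the near-critical scaling limit magnetization field); $\Phi^h(f)$ denotes the field paired with a test function $f$. $C_0^\infty(\mathbb{R}^2)$ is the set of smooth compactly supported functions. *)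

(* Defs.v *)
From HB Require Import structures.
From mathcomp Require Import all_boot all_order all_algebra.
From mathcomp Require Import all_classical all_reals all_analysis.
Set Implicit Arguments. Unset Strict Implicit. Unset Printing Implicit Defensive.
Import Order.TTheory GRing.Theory Num.Theory.
Import numFieldNormedType.Exports.
Local Open Scope classical_set_scope.
Local Open Scope ring_scope.

Section Defs.
Variable R : realType.

Definition Dseq (vs : seq (R * R)) (f : R * R -> R) : R * R -> R :=
  foldr (fun v g => 'D_v g) f vs.

Definition smooth2 (f : R * R -> R) : Prop :=
  forall vs : seq (R * R),
    continuous (Dseq vs f) /\ forall x v, derivable (Dseq vs f) x v.

Definition compact_support2 (f : R * R -> R) : Prop :=
  exists K : set (R * R), compact K /\ forall x, ~ K x -> f x = 0.

Definition testfun (f : R * R -> R) : Prop := smooth2 f /\ compact_support2 f.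

Definition eucl (x y : R * R) : R :=
  Num.sqrt ((x.1 - y.1) ^+ 2 + (x.2 - y.2) ^+ 2).

Definition site := (int * int)%type.
Definition addZ2 (z e : site) : site := (z.1 + e.1, z.2 + e.2)%R.
Definition dirs : seq site := [:: (1, 0); (-1, 0); (0, 1); (0, -1)]%R.

Definition box (L : nat) := ('I_(2 * L + 1) * 'I_(2 * L + 1))%type.
Definition pos L (b : box L) : site := ((b.1)%:Z - L%:Z, (b.2)%:Z - L%:Z)%R.
Definition idx L (z : site) : option (box L) :=
  if ((0 <= z.1 + L%:Z)%R) && ((0 <= z.2 + L%:Z)%R) then
    match (insub (absz (z.1 + L%:Z)%R) : option 'I_(2 * L + 1)),
          (insub (absz (z.2 + L%:Z)%R) : option 'I_(2 * L + 1)) with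
    | Some i, Some j => Some (i, j)
    | _, _ => None
    end
  else None.

(* spin configuration on Z^2 from a configuration in the box, with +
   boundary condition outside the box *)
Definition spin L (s : {ffun box L -> bool}) (z : site) : R :=
  match idx L z with
  | Some b => if s b then 1 else -1
  | None => 1
  end.

(* sum over nearest-neighbour bonds with at least one endpoint in the box
   (interior bonds are seen twice, hence the 1/2) *)
Definition energy L (s : {ffun box L -> bool}) : R :=
  \sum_(b : box L) \sum_(e <- dirs)
     (if idx L (addZ2 (pos b) e) is Some _ then 2^-1 else 1)
       * spin s (pos b) * spin s (addZ2 (pos b) e).

Definition magn L (s : {ffun box L -> bool}) : R :=
  \sum_(b : box L) spin s (pos b).

Definition gibbs_w (beta H : R) L (s : {ffun box L -> bool}) : R :=
  expR (beta * energy s + H * magn s).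

Definition fv_exp (beta H : R) L (F : (site -> R) -> R) : R :=
  (\sum_(s : {ffun box L -> bool}) gibbs_w beta H s * F (spin s))
  / (\sum_(s : {ffun box L -> bool}) gibbs_w beta H s).

Definition iv_exp (beta H : R) (F : (site -> R) -> R) : R :=
  limn (fun L => fv_exp beta H L F).

Definition beta_c : R := 2^-1 * ln (1 + Num.sqrt 2).

Definition ising_exp (a h : R) (F : (site -> R) -> R) : R :=
  iv_exp beta_c (powR a (15 / 8) * h) F.

(* truncated two-point function <s_x ; s_y>_{a,h}, x = a z, y = a w *)
Definition trunc2 (a h : R) (z w : site) : R :=
  ising_exp a h (fun s => s z * s w)
  - ising_exp a h (fun s => s z) * ising_exp a h (fun s => s w).

Definition latt (a : R) (z : site) : R * R := (a * z.1%:~R, a * z.2%:~R).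

(* lattice magnetization field Phi^{a,h}(f) = a^{15/8} sum_x s_x f(x),
   as a function of the spin field (finite sum for compactly supported f,
   written as the limit of sums over growing boxes) *)
Definition latt_field (a : R) (f : R * R -> R) (s : site -> R) : R :=
  limn (fun K : nat => powR a (15 / 8) *
    \sum_(i < 2 * K + 1) \sum_(j < 2 * K + 1)
       s ((i%:Z - K%:Z), (j%:Z - K%:Z))%R
       * f (latt a ((i%:Z - K%:Z), (j%:Z - K%:Z))%R)).

End Defs.

(* Main.v *)
Require Import Defs.
From HB Require Import structures.
From mathcomp Require Import all_boot all_order all_algebra.
From mathcomp Require Import all_classical all_reals all_analysis.
From mathcomp Require Import measurable_realfun ring lra zify.
Import Order.TTheory GRing.Theory Num.Theory.
Import numFieldNormedType.Exports.
Local Open Scope classical_set_scope.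
Local Open Scope ring_scope.

(* Write [clamp K] for truncation to [-K, K], X_a and Y_a for the lattice fields
   paired with f and g. A function F of the spins is dominated by G when every
   increase of the spins changes F by at most the change of G. The FKG inequality
   applied to G1 +- F1 and G2 +- F2 gives |Cov(F1, F2)| <= Cov(G1, G2), and
   [clamp K] of X_a is dominated by the field paired with |f|. Hence
   |Cov(clamp K X_a, clamp K Y_a)| <= a^(15/4) sum |f(x)| |g(y)| <s_x ; s_y>,
   uniformly in K and without any moment bound beyond the second. By the lattice
   bound the right-hand side is at most c times a Riemann sum of the kernel, plus
   a diagonal term O(a^(7/4)). The left-hand side only involves bounded continuous
   functions, so convergence in law lets a -> 0. Taking f = g bounds the variance
   of the truncated limit field uniformly in K, which puts the field in L^2, and
   then K -> oo by dominated convergence. The infinite-volume limits exist because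
   expectations of increasing functions decrease with the box under + boundary
   conditions, and a dominated function is a difference of increasing ones. *)

Set Implicit Arguments.
Unset Strict Implicit.
Unset Printing Implicit Defensive.

(** * The FKG inequality *)

Section FourFunctions.
Context {R : realType} {T : finType}.
Local Notation conf := {ffun T -> bool}.
Implicit Types (s t : conf) (x : T) (u v w : conf -> R).

Definition upd s x b : conf := [ffun y => if y == x then b else s y].
Definition flip x s : conf := upd s x (~~ s x).
Definition cjoin s t : conf := [ffun y => s y || t y].
Definition cmeet s t : conf := [ffun y => s y && t y].
(** Summing out the coordinate [x] keeps the type [conf]: the result is a function on all
    configurations that ignores [x], so coordinates can be summed out one after another without
    changing the index type. *)
Definition psum x u : conf -> R := fun s => u (upd s x true) + u (upd s x false).
Definition psums (xs : seq T) u : conf -> R := foldr psum u xs.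
Definition cle s t := forall x, s x ==> t x.
Definition increasing u := forall s t, cle s t -> u s <= u t.

Lemma upd_id s x : upd s x (s x) = s.
Proof. by apply/ffunP => y; rewrite ffunE; case: eqP => [->|]. Qed.

Lemma updd s x b b' : upd (upd s x b) x b' = upd s x b'.
Proof. by apply/ffunP => y; rewrite !ffunE; case: eqP. Qed.

Lemma updC s x y b b' : x != y ->
  upd (upd s x b) y b' = upd (upd s y b') x b.
Proof.
move=> xy; apply/ffunP => z; rewrite !ffunE.
by case: (eqVneq z y) => // ->; rewrite eq_sym (negbTE xy).
Qed.

Lemma flipK x : involutive (flip x).
Proof.
by move=> s; rewrite /flip updd ffunE eqxx negbK upd_id.
Qed.

Lemma psumE x u s : psum x u s = u s + u (flip x s).
Proof.
have E := upd_id s x; rewrite /psum /flip.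
case: (s x) in E *; first by rewrite E.
by rewrite addrC E.
Qed.

Lemma sum_psum x u : \sum_s psum x u s = 2 * \sum_s u s.
Proof.
under eq_bigr do rewrite psumE.
rewrite big_split/= [X in _ + X](_ : _ = \sum_s u s); last first.
  by rewrite [RHS](reindex_inj (inv_inj (flipK x))).
by ring.
Qed.

Lemma psums_upd xs u s x b : x \in xs ->
  psums xs u (upd s x b) = psums xs u s.
Proof.
elim: xs s => //= y xs IH s; rewrite inE /psum.
case: (eqVneq x y) => [->|xy] /= h; first by rewrite !updd.
by rewrite !(@updC _ x y) // !IH.
Qed.

(** Once every coordinate is summed out the function is constant, and each summation doubles the
    total; dividing by the number 2^|T| of configurations identifies the constant. *)
Lemma psums_enum u s : psums (enum T) u s = \sum_t u t.
Proof.
have cst t : psums (enum T) u t = psums (enum T) u s.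
  (* Any [t] arises from [s] by overwriting all coordinates in turn, and no single overwriting
     changes the value. *)
  have {1}-> : t = foldr (fun x r => upd r x (t x)) s (enum T).
    apply/ffunP => y; have : y \in enum T by rewrite mem_enum.
    elim: (enum T) => //= z xs IH; rewrite inE ffunE.
    by case: eqP => [->|_] //= /IH.
  elim: {2}(enum T) => //= x xs IH.
  by rewrite psums_upd ?mem_enum.
have sm xs : \sum_t psums xs u t = 2 ^+ size xs * \sum_t u t.
  elim: xs => [|x xs IH] /=; first by rewrite mul1r.
  by rewrite sum_psum IH exprS mulrA.
have := sm (enum T); under eq_bigr do rewrite cst.
rewrite sumr_const card_ffun card_bool -cardT -[in LHS]mulr_natl natrX.
by apply: mulfI; rewrite expf_neq0.
Qed.

(** The one-coordinate case of the four functions theorem. With x = a0 b1, y = a1 b0, p = c1 d0, q =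
    c0 d1, the bounds x, y <= p give (p - x)(p - y) >= 0, hence p(x + y) <= p^2 + xy <= p(p + q). *)
Lemma four_point (a0 a1 b0 b1 c0 c1 d0 d1 : R) :
  0 <= a0 -> 0 <= a1 -> 0 <= b0 -> 0 <= b1 ->
  0 <= c0 -> 0 <= c1 -> 0 <= d0 -> 0 <= d1 ->
  a0 * b0 <= c0 * d0 -> a1 * b0 <= c1 * d0 ->
  a0 * b1 <= c1 * d0 -> a1 * b1 <= c1 * d1 ->
  (a1 + a0) * (b1 + b0) <= (c1 + c0) * (d1 + d0).
Proof.
move=> ha0 ha1 hb0 hb1 hc0 hc1 hd0 hd1 h00 h10 h01 h11.
suff : a0 * b1 + a1 * b0 <= c1 * d0 + c0 * d1 by lra.
have : (a0 * b1) * (a1 * b0) <= (c1 * d0) * (c0 * d1).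
  rewrite [leLHS](_ : _ = (a0 * b0) * (a1 * b1)); last by ring.
  rewrite [leRHS](_ : _ = (c0 * d0) * (c1 * d1)); last by ring.
  by apply: ler_pM => //; exact: mulr_ge0.
have : 0 <= c0 * d1 by exact: mulr_ge0.
have : 0 <= a0 * b1 by exact: mulr_ge0.
have : 0 <= a1 * b0 by exact: mulr_ge0.
move: (a0 * b1) (a1 * b0) (c1 * d0) (c0 * d1) h01 h10 => x y p q xp yp y0 x0 q0 xy.
have : 0 <= p by lra.
rewrite le_eqVlt => /predU1P[p0|p0]; first by lra.
rewrite -(ler_pM2l p0).
have : 0 <= (p - x) * (p - y) by apply: mulr_ge0; lra.
by lra.
Qed.

Definition four_cond (a b c d : conf -> R) :=
  forall s t, a s * b t <= c (cjoin s t) * d (cmeet s t).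

(** The Ahlswede-Daykin theorem. The pointwise condition survives summing out one coordinate by
    [four_point]; after all coordinates it is the inequality between the total sums. *)
Lemma four_functions (a b c d : conf -> R) :
  (forall s, 0 <= a s) -> (forall s, 0 <= b s) ->
  (forall s, 0 <= c s) -> (forall s, 0 <= d s) ->
  four_cond a b c d ->
  (\sum_s a s) * (\sum_s b s) <= (\sum_s c s) * (\sum_s d s).
Proof.
move=> a0 b0 c0 d0 abcd; pose s0 : conf := [ffun=> true].
rewrite -!(psums_enum _ s0).
have ge0 xs u : (forall s, 0 <= u s) -> forall s, 0 <= psums xs u s.
  by move=> u0; elim: xs => //= x xs IH s; rewrite addr_ge0.
have jU s t x e e' : cjoin (upd s x e) (upd t x e') = upd (cjoin s t) x (e || e').
  by apply/ffunP => y; rewrite !ffunE; case: eqP.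
have mU s t x e e' : cmeet (upd s x e) (upd t x e') = upd (cmeet s t) x (e && e').
  by apply/ffunP => y; rewrite !ffunE; case: eqP.
suff H xs : four_cond (psums xs a) (psums xs b) (psums xs c) (psums xs d).
  rewrite (psums_enum d s0) -(psums_enum d (cmeet s0 s0)).
  rewrite (psums_enum c s0) -(psums_enum c (cjoin s0 s0)).
  exact: H.
elim: xs => [|x xs IH] //= s t; rewrite /psum.
apply: four_point; try exact: ge0.
- by have := IH (upd s x false) (upd t x false); rewrite jU mU.
- by have := IH (upd s x true) (upd t x false); rewrite jU mU.
- by have := IH (upd s x false) (upd t x true); rewrite jU mU.
- by have := IH (upd s x true) (upd t x true); rewrite jU mU.
Qed.

(** The four functions theorem is applied to w u, w v, w u v and w, after a shift of u and v that
    makes them nonnegative. *)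
Theorem fkg w u v :
  (forall s, 0 <= w s) ->
  (forall s t, w s * w t <= w (cjoin s t) * w (cmeet s t)) ->
  increasing u -> increasing v ->
  (\sum_s w s * u s) * (\sum_s w s * v s) <=
  (\sum_s w s * (u s * v s)) * (\sum_s w s).
Proof.
move=> w0 wlog iu iv; pose s0 : conf := [ffun=> false].
have s0P s : cle s0 s by move=> x; rewrite ffunE.
(* The all-false configuration is the least one, so subtracting the values there gives nonnegative
   functions; the final inequality is invariant under such shifts. *)
pose u' s := u s - u s0; pose v' s := v s - v s0.
have u'0 s : 0 <= u' s by rewrite subr_ge0 iu.
have v'0 s : 0 <= v' s by rewrite subr_ge0 iv.
have : (\sum_s w s * u' s) * (\sum_s w s * v' s) <=
  (\sum_s w s * (u' s * v' s)) * (\sum_s w s).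
  apply: four_functions => [s|s|s|//|s t]; rewrite ?mulr_ge0//.
  rewrite mulrACA [leRHS]mulrAC; apply: ler_pM; rewrite ?mulr_ge0//.
  apply: ler_pM => //; rewrite lerD2r.
  - by apply: iu => x; rewrite ffunE; case: (s x).
  - by apply: iv => x; rewrite ffunE; case: (t x); rewrite ?orbT ?implybT.
have su : \sum_s w s * u' s = \sum_s w s * u s - (\sum_s w s) * u s0.
  by rewrite mulr_suml -sumrB; apply: eq_bigr => s _; rewrite mulrBr.
have sv : \sum_s w s * v' s = \sum_s w s * v s - (\sum_s w s) * v s0.
  by rewrite mulr_suml -sumrB; apply: eq_bigr => s _; rewrite mulrBr.
have suv : \sum_s w s * (u' s * v' s) = \sum_s w s * (u s * v s)
    - (\sum_s w s * u s) * v s0 - (\sum_s w s * v s) * u s0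
    + (\sum_s w s) * (u s0 * v s0).
  rewrite !mulr_suml -!sumrB -big_split; apply: eq_bigr => s _ /=.
  by rewrite /u' /v'; ring.
rewrite su sv suv.
move: (\sum_s w s) (\sum_s w s * u s) (\sum_s w s * v s)
  (\sum_s w s * (u s * v s)) => W U V UV h.
rewrite -subr_ge0; move: h; rewrite -subr_ge0.
by congr (0 <= _); ring.
Qed.

End FourFunctions.

(** * Finite-volume Ising measures *)

Definition inbox (L : nat) (z : site) : bool :=
  (`|z.1| <= L%:Z) && (`|z.2| <= L%:Z).
Definition sites (L : nat) : seq site := [seq pos b | b <- enum {: box L}].

Lemma idx_pos L (b : box L) : idx L (pos b) = Some b.
Proof.
case: b => i j; rewrite /idx /pos /= !subrK /=.
by rewrite !valK.
Qed.

Lemma pos_idx L z b : idx L z = Some b -> pos b = z.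
Proof.
rewrite /idx; case: ifP => // /andP[h1 h2].
case: insubP => // i _ ei; case: insubP => // j _ ej [<-].
case: z h1 h2 ei ej => x y /= h1 h2 ei ej.
by rewrite /pos /= ei ej; congr (_, _); lia.
Qed.

Lemma inbox_pos L (b : box L) : inbox L (pos b).
Proof.
case: b => i j; rewrite /inbox /pos /=; have := ltn_ord i; have := ltn_ord j.
by move=> *; apply/andP; split; lia.
Qed.

Lemma inbox_idx L z : inbox L z -> exists b : box L, idx L z = Some b.
Proof.
case: z => x y; rewrite /inbox /idx /= => /andP[hx hy].
have -> : (0 <= x + L%:Z)%R by lia.
have -> : (0 <= y + L%:Z)%R by lia.
have lx : (absz (x + L%:Z)%R < 2 * L + 1)%N by lia.
have ly : (absz (y + L%:Z)%R < 2 * L + 1)%N by lia.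
case: insubP => [i _ _|]; last by rewrite lx.
case: insubP => [j _ _|]; last by rewrite ly.
by exists (i, j).
Qed.

Lemma idx_none L z : ~~ inbox L z -> idx L z = None.
Proof.
move=> h; case E : idx => [b|] //; move: h.
by rewrite -(pos_idx E) inbox_pos.
Qed.

Lemma mem_sites L z : (z \in sites L) = inbox L z.
Proof.
apply/mapP/idP => [[b _ ->]|]; first exact: inbox_pos.
by move=> /inbox_idx[b /pos_idx <-]; exists b; rewrite ?mem_enum.
Qed.

Lemma pos_inj L : injective (@pos L).
Proof. by move=> b b' e; apply: Some_inj; rewrite -!idx_pos e. Qed.

Lemma uniq_sites L : uniq (sites L).
Proof. by rewrite map_inj_uniq ?enum_uniq //; exact: pos_inj. Qed.

Lemma inbox_le L M z : (L <= M)%N -> inbox L z -> inbox M z.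
Proof. by move=> LM /andP[h1 h2]; apply/andP; split; lia. Qed.

Lemma inbox_nbr L M z e : e \in dirs -> (L < M)%N ->
  inbox L (addZ2 z e) -> inbox M z.
Proof.
case: z => x y; rewrite !inE => he LM /andP[/= h1 h2].
by case/or4P: he h1 h2 => /eqP -> /= h1 h2; apply/andP; split => /=; lia.
Qed.

Lemma addZ2K z e : addZ2 (addZ2 z e) (- e.1, - e.2) = z.
Proof. by case: z e => x y [u v]; rewrite /addZ2 /= !addrK. Qed.

Lemma addZ2NK z e : addZ2 (addZ2 z (- e.1, - e.2)) e = z.
Proof. by case: z e => x y [u v]; rewrite /addZ2 /= !subrK. Qed.

Section Gibbs.
Context {R : realType}.
Implicit Types (beta H : R) (F G : (site -> R) -> R) (tau : site -> R).

Lemma sum_box L (f : site -> R) : \sum_(b : box L) f (pos b) = \sum_(z <- sites L) f z.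
Proof. by rewrite /sites big_map big_enum. Qed.

Lemma sum_sites_le L M (f : site -> R) : (L <= M)%N ->
  \sum_(z <- sites M | inbox L z) f z = \sum_(z <- sites L) f z.
Proof.
move=> LM; rewrite -big_filter; apply: (perm_big (sites L)) => /=; apply: uniq_perm.
- by rewrite filter_uniq ?uniq_sites.
- exact: uniq_sites.
move=> z; rewrite mem_filter !mem_sites andb_idr//; exact: inbox_le.
Qed.

(** Bonds with exactly one endpoint in the box are listed on the left by their outer endpoint and on
    the right by their inner one; L < M leaves room for the outer endpoints. *)
Lemma sum_sites_shift L M e (f : site -> R) : e \in dirs -> (L < M)%N ->
  \sum_(z <- sites M | inbox L (addZ2 z e) && ~~ inbox L z) f z =
  \sum_(z <- sites L | ~~ inbox L (addZ2 z (- e.1, - e.2)))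
    f (addZ2 z (- e.1, - e.2)).
Proof.
move=> he LM; pose r := [seq addZ2 z (- e.1, - e.2) | z <- sites L
  & ~~ inbox L (addZ2 z (- e.1, - e.2))].
transitivity (\sum_(z <- r) f z); last by rewrite big_map big_filter.
rewrite -big_filter; apply: (perm_big r) => /=; apply: uniq_perm.
- by rewrite filter_uniq ?uniq_sites.
- rewrite map_inj_uniq ?filter_uniq ?uniq_sites // => z z' E.
  by rewrite -(addZ2NK z e) E addZ2NK.
move=> z; rewrite mem_filter mem_sites; apply/idP/mapP.
  move=> /andP[/andP[h1 h2] h3]; exists (addZ2 z e); last by rewrite addZ2K.
  by rewrite mem_filter addZ2K h2 mem_sites.
move=> [w]; rewrite mem_filter mem_sites => /andP[h1 h2] ->.
by rewrite h1 addZ2NK h2 /= (inbox_nbr he LM) // addZ2NK.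
Qed.

(** A symmetric form of the energy: every oriented bond that meets the box has weight 1/2, without
    distinguishing interior from boundary bonds. Energies of nested boxes then become sums over
    nested index sets. *)
Lemma energyE L M (s : {ffun box L -> bool}) : (L < M)%N ->
  energy R s = 2^-1 * \sum_(e <- dirs)
    \sum_(z <- sites M | inbox L z || inbox L (addZ2 z e))
       spin R s z * spin R s (addZ2 z e).
Proof.
move=> LM; set tau := spin R s.
(* A boundary bond has weight 1 = 1/2 + 1/2; the second half is reassigned below to the same bond
   oriented from its outer endpoint. *)
have -> : energy R s = \sum_(z <- sites L) \sum_(e <- dirs)
    (2^-1 * (tau z * tau (addZ2 z e)) +
     2^-1 * (if ~~ inbox L (addZ2 z e) then tau z * tau (addZ2 z e) else 0)).
  rewrite /energy -sum_box; apply: eq_bigr => b _; apply: eq_bigr => e _.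
  rewrite -/tau; case: (boolP (inbox L (addZ2 (pos b) e))) => h.
    by have [b' ->] := inbox_idx h; rewrite /= -mulrA; ring.
  by rewrite (idx_none h) /=; field.
rewrite exchange_big /=; under eq_bigr do rewrite big_split/= -!mulr_sumr.
rewrite big_split/= -!mulr_sumr -mulrDr; congr (_ * _).
have E : \sum_(e <- dirs) \sum_(z <- sites M | inbox L z || inbox L (addZ2 z e))
       tau z * tau (addZ2 z e) =
  \sum_(e <- dirs) \sum_(z <- sites L) tau z * tau (addZ2 z e) +
  \sum_(e <- dirs) \sum_(z <- sites L | ~~ inbox L (addZ2 z (- e.1, - e.2)))
    tau z * tau (addZ2 z (- e.1, - e.2)).
  rewrite -big_split /= big_seq [RHS]big_seq; apply: eq_bigr => e he.
  rewrite (bigID (inbox L)) /=; congr (_ + _).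
    rewrite -(sum_sites_le _ (ltnW LM)).
    by apply: eq_bigl => z; case: (inbox L z); rewrite ?andbF.
  rewrite (eq_bigl (fun z => inbox L (addZ2 z e) && ~~ inbox L z)); last first.
    by move=> z /=; case: (inbox L z); rewrite ?andbF ?andbT.
  rewrite (sum_sites_shift (fun z => tau z * tau (addZ2 z e)) he LM).
  by apply: eq_bigr => z _; rewrite addZ2NK mulrC.
(* Reversing the bonds only permutes [dirs], which is stable under negation. *)
rewrite E /dirs !big_cons !big_nil /= ?oppr0 ?opprK.
by rewrite -!big_mkcond /=; ring.
Qed.
End Gibbs.

(** * Nested boxes, positive association and monotonicity in the volume *)

Section FiniteVolume.
Context {R : realType}.
Implicit Types (beta H : R) (F G : (site -> R) -> R) (tau : site -> R).

(** The default [true] is the + boundary condition, so [ext] does not change the spin field on the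
    lattice. *)
Definition ext L (t : {ffun box L -> bool}) : {ffun box L.+1 -> bool} :=
  [ffun b => if idx L (pos b) is Some b' then t b' else true].
Definition restr L (s : {ffun box L.+1 -> bool}) : {ffun box L -> bool} :=
  [ffun b => if idx L.+1 (pos b) is Some b' then s b' else true].
Definition plus_outside L (s : {ffun box L.+1 -> bool}) : bool :=
  [forall b, ~~ inbox L (pos b) ==> s b].

Lemma spin_out L (s : {ffun box L -> bool}) z : ~~ inbox L z -> spin R s z = 1.
Proof. by move=> /idx_none; rewrite /spin => ->. Qed.

Lemma spin_ext L (t : {ffun box L -> bool}) : spin R (ext t) = spin R t.
Proof.
apply/funext => z; rewrite /spin.
case E : (idx L.+1 z) => [b|]; first by rewrite ffunE (pos_idx E); case: idx.
rewrite idx_none //; apply/negP => /(inbox_le (leqnSn L))/inbox_idx[b].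
by rewrite E.
Qed.

Lemma ext_plus L (t : {ffun box L -> bool}) : plus_outside (ext t).
Proof.
by apply/forallP => b; apply/implyP => /idx_none; rewrite ffunE => ->.
Qed.

Lemma extK L : cancel (@ext L) (@restr L).
Proof.
move=> t; apply/ffunP => b; rewrite ffunE.
have /inbox_idx[b' E] := inbox_le (leqnSn L) (inbox_pos b).
by rewrite E ffunE (pos_idx E) idx_pos.
Qed.

Lemma restrK L (s : {ffun box L.+1 -> bool}) :
  plus_outside s -> ext (restr s) = s.
Proof.
move=> /forallP h; apply/ffunP => b; rewrite ffunE.
case: (boolP (inbox L (pos b))) => hb.
  by have [b' E] := inbox_idx hb; rewrite E ffunE (pos_idx E) idx_pos.
by rewrite idx_none //; have /implyP/(_ hb) -> := h b.
Qed.

Lemma sum_plus_outside L (f : {ffun box L.+1 -> bool} -> R) :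
  \sum_(s | plus_outside s) f s = \sum_t f (ext t).
Proof.
rewrite (reindex_onto (@ext L) (@restr L)); last by move=> s /restrK.
by apply: eq_bigl => t; rewrite ext_plus extK eqxx.
Qed.

(** The bonds that meet the larger box but not the smaller one join sites whose spins are both +1
    after extension, so their contribution does not depend on [t]. *)
Lemma energy_ext L : exists K : R, forall t : {ffun box L -> bool},
  energy R (ext t) = energy R t + K.
Proof.
exists (2^-1 * \sum_(e <- dirs) \sum_(z <- sites L.+2 |
  (inbox L.+1 z || inbox L.+1 (addZ2 z e)) &&
  ~~ (inbox L z || inbox L (addZ2 z e))) 1) => t.
rewrite (energyE _ (ltnSn L.+1)) (energyE (M := L.+2) _ (leqnSn _)) spin_ext.
rewrite -mulrDr -big_split/=; congr (_ * _); apply: eq_bigr => e _.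
rewrite (bigID (fun z => inbox L z || inbox L (addZ2 z e))) /=; congr (_ + _).
  apply: eq_bigl => z; rewrite andb_idl // => /orP[] /(inbox_le (leqnSn L)) -> //.
  by rewrite orbT.
apply: eq_bigr => z /andP[_]; rewrite negb_or => /andP[h1 h2].
by rewrite !spin_out // mulr1.
Qed.

Lemma magn_ext L : exists K : R, forall t : {ffun box L -> bool},
  magn R (ext t) = magn R t + K.
Proof.
exists (\sum_(z <- sites L.+1 | ~~ inbox L z) 1) => t.
rewrite /magn !sum_box spin_ext (bigID (inbox L)) /= sum_sites_le //.
by congr (_ + _); apply: eq_bigr => z /spin_out ->.
Qed.

Lemma gibbs_w_gt0 beta H L (s : {ffun box L -> bool}) : 0 < gibbs_w beta H s.
Proof. exact: expR_gt0. Qed.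

(** The factor [K] is the same for all configurations and cancels in normalised expectations. *)
Lemma gibbs_w_ext beta H L : exists2 K : R, 0 < K &
  forall t : {ffun box L -> bool}, gibbs_w beta H (ext t) = K * gibbs_w beta H t.
Proof.
have [K1 h1] := energy_ext L; have [K2 h2] := magn_ext L.
exists (expR (beta * K1 + H * K2)); first exact: expR_gt0.
by move=> t; rewrite /gibbs_w h1 h2 -expRD; congr expR; ring.
Qed.

Lemma spin_le1 L (s : {ffun box L -> bool}) z : `|spin R s z| <= 1.
Proof.
by rewrite /spin; case: idx => [b|]; [case: (s b)|]; rewrite ?normrN normr1.
Qed.

Lemma spin_sqr L (s : {ffun box L -> bool}) z : spin R s z * spin R s z = 1.
Proof.
by rewrite /spin; case: idx => [b|]; [case: (s b)|]; rewrite ?mulrNN mulr1.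
Qed.

Lemma spin_mono L (s t : {ffun box L -> bool}) z : cle s t ->
  spin R s z <= spin R t z.
Proof.
move=> st; rewrite /spin; case: idx => // b.
by have := st b; case: (s b); case: (t b) => //= _; rewrite lerN10 || lra.
Qed.

Lemma spin_joinmeet L (s t : {ffun box L -> bool}) z :
  spin R (cjoin s t) z + spin R (cmeet s t) z = spin R s z + spin R t z.
Proof.
rewrite /spin; case: idx => // b; rewrite !ffunE.
by case: (s b); case: (t b) => //=; rewrite addrC.
Qed.

Lemma spin_supermodular L (s t : {ffun box L -> bool}) y z :
  spin R s y * spin R s z + spin R t y * spin R t z <=
  spin R (cjoin s t) y * spin R (cjoin s t) z +
  spin R (cmeet s t) y * spin R (cmeet s t) z.
Proof.
rewrite /spin; case: (idx L y) => [b|]; case: (idx L z) => [b'|] //;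
  rewrite !ffunE.
- by case: (s b); case: (t b); case: (s b'); case: (t b') => /=; lra.
- by case: (s b); case: (t b) => /=; lra.
- by case: (s b'); case: (t b') => /=; lra.
Qed.

(** The FKG lattice condition: the magnetization is modular, and the energy is supermodular bond by
    bond, which is preserved by a ferromagnetic coupling [beta] >= 0. *)
Lemma gibbs_w_lattice beta H L (s t : {ffun box L -> bool}) : 0 <= beta ->
  gibbs_w beta H s * gibbs_w beta H t <=
  gibbs_w beta H (cjoin s t) * gibbs_w beta H (cmeet s t).
Proof.
move=> b0; rewrite /gibbs_w -!expRD ler_expR.
have m : magn R s + magn R t = magn R (cjoin s t) + magn R (cmeet s t).
  by rewrite /magn -!big_split; apply: eq_bigr => b _ /=;
  rewrite spin_joinmeet.
have e : energy R s + energy R t <= energy R (cjoin s t) + energy R (cmeet s t).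
  rewrite /energy -!big_split; apply: ler_sum => b _.
  rewrite -!big_split; apply: ler_sum => z _ /=.
  rewrite -!mulrA -!mulrDr; apply: ler_wpM2l; last exact: spin_supermodular.
  by case: idx => // _; rewrite invr_ge0.
have -> : beta * energy R s + H * magn R s + (beta * energy R t + H * magn R t) =
  beta * (energy R s + energy R t) + H * (magn R s + magn R t) by ring.
have -> : beta * energy R (cjoin s t) + H * magn R (cjoin s t) +
   (beta * energy R (cmeet s t) + H * magn R (cmeet s t)) =
  beta * (energy R (cjoin s t) + energy R (cmeet s t)) +
  H * (magn R (cjoin s t) + magn R (cmeet s t)) by ring.
by rewrite -m lerD2r ler_wpM2l.
Qed.

Definition bounded_field tau := forall z, `|tau z| <= 1.

Definition incr F := forall tau tau', bounded_field tau -> bounded_field tau' ->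
  (forall z, tau z <= tau' z) -> F tau <= F tau'.

(** Equivalently, both G + F and G - F are increasing on bounded fields; this is the form in which
    the FKG inequality is used. *)
Definition dom F G := forall tau tau', bounded_field tau -> bounded_field tau' ->
  (forall z, tau z <= tau' z) -> `|F tau' - F tau| <= G tau' - G tau.

Lemma incr_spin F L : incr F ->
  increasing (fun s : {ffun box L -> bool} => F (spin R s)).
Proof.
by move=> iF s t st; apply: iF => z; rewrite ?spin_le1 // spin_mono.
Qed.

Section FV.
Variables (beta H : R).
Hypothesis beta0 : 0 <= beta.
Local Notation fv := (fv_exp beta H).
Local Notation Z L := (\sum_(s : {ffun box L -> bool}) gibbs_w beta H s).

Lemma Z_gt0 L : 0 < Z L.
Proof.
rewrite (bigD1 [ffun=> true]) //= ltr_pwDl ?gibbs_w_gt0 //.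
by apply: sumr_ge0 => s _; exact/ltW/gibbs_w_gt0.
Qed.

Lemma fv_expD L F G : fv L (fun tau => F tau + G tau) = fv L F + fv L G.
Proof.
rewrite /fv_exp -mulrDl -big_split; congr (_ / _).
by apply: eq_bigr => s _; rewrite mulrDr.
Qed.

Lemma fv_expZ L k F : fv L (fun tau => k * F tau) = k * fv L F.
Proof.
rewrite /fv_exp mulrA mulr_sumr; congr (_ / _).
by apply: eq_bigr => s _; rewrite mulrCA.
Qed.

Lemma eq_fv_exp L F G : (forall s : {ffun box L -> bool},
  F (spin R s) = G (spin R s)) -> fv L F = fv L G.
Proof.
by move=> FG; rewrite /fv_exp; congr (_ / _); apply: eq_bigr => s _; rewrite FG.
Qed.

Lemma fv_exp_cst L k : fv L (fun=> k) = k.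
Proof. by rewrite /fv_exp -mulr_suml mulrAC divff ?mul1r// gt_eqF ?Z_gt0. Qed.

Lemma ler_fv_exp L F G : (forall s : {ffun box L -> bool},
  F (spin R s) <= G (spin R s)) -> fv L F <= fv L G.
Proof.
move=> FG; apply: ler_wpM2r; first by rewrite invr_ge0 ltW ?Z_gt0.
by apply: ler_sum => s _; apply: ler_wpM2l; rewrite ?FG // ltW ?gibbs_w_gt0.
Qed.

Lemma fv_fkg L F G : incr F -> incr G ->
  fv L F * fv L G <= fv L (fun tau => F tau * G tau).
Proof.
move=> iF iG; rewrite /fv_exp mulrACA -invfM.
rewrite ler_pdivrMr ?mulr_gt0 ?Z_gt0//.
rewrite mulrA mulfVK ?gt_eqF ?Z_gt0//.
apply: fkg; [|move=> s t|exact: incr_spin|exact: incr_spin].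
- by move=> s; exact/ltW/gibbs_w_gt0.
- exact: gibbs_w_lattice.
Qed.

(* Conditioning the measure of the larger box on the increasing event
   [plus_outside] gives the measure of the smaller one. *)
Lemma fv_exp_decr F L : incr F -> fv L.+1 F <= fv L F.
Proof.
move=> iF; have [K K0 hK] := gibbs_w_ext beta H L.
pose B (s : {ffun box L.+1 -> bool}) : R := (plus_outside s)%:R.
have iB : increasing B.
  move=> s t st; rewrite /B ler_nat; case: (boolP (plus_outside s)) => // /forallP h.
  suff -> : plus_outside t by [].
  apply/forallP => b; apply/implyP => hb.
  by have := h b; rewrite hb /=; have := st b; case: (s b).
have SB f : \sum_(s : {ffun box L.+1 -> bool}) gibbs_w beta H s * (f (spin R s) * B s) =
    K * \sum_(t : {ffun box L -> bool}) gibbs_w beta H t * f (spin R t).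
  transitivity (\sum_(s : {ffun box L.+1 -> bool} | plus_outside s)
      gibbs_w beta H s * f (spin R s)).
    rewrite [RHS]big_mkcond; apply: eq_bigr => s _; rewrite /B.
    by case: ifP => _; rewrite ?mulr1 ?mulr0.
  rewrite sum_plus_outside mulr_sumr; apply: eq_bigr => t _.
  by rewrite hK spin_ext mulrA.
have wge0 (s : {ffun box L.+1 -> bool}) : 0 <= gibbs_w beta H s.
  exact/ltW/gibbs_w_gt0.
(* The FKG inequality for [F] and the indicator [B] says that conditioning on [plus_outside] can
   only raise the expectation of [F]. *)
have := fkg wge0 (fun s t => gibbs_w_lattice H s t beta0) (incr_spin iF) iB.
have SB1 : \sum_(s : {ffun box L.+1 -> bool}) gibbs_w beta H s * B s = K * Z L.
  transitivity (\sum_(s : {ffun box L.+1 -> bool}) gibbs_w beta H s * (1 * B s)).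
    by apply: eq_bigr => s _; rewrite mul1r.
  by rewrite (SB (fun=> 1)); congr (_ * _); apply: eq_bigr => t _; rewrite mulr1.
rewrite SB SB1.
rewrite mulrCA -!mulrA ler_pM2l // => h.
by rewrite /fv_exp ler_pdivrMr ?Z_gt0// mulrAC ler_pdivlMr ?Z_gt0.
Qed.

Lemma dom_incr F G : dom F G -> incr G.
Proof.
move=> FG s t hs ht st; rewrite -subr_ge0; apply: le_trans (FG s t hs ht st).
exact: normr_ge0.
Qed.

Lemma dom_incrD F G : dom F G -> incr (fun tau => G tau + F tau).
Proof.
move=> FG s t hs ht st; have := FG s t hs ht st; rewrite ler_norml; lra.
Qed.

Lemma dom_incrB F G : dom F G -> incr (fun tau => G tau - F tau).
Proof.
move=> FG s t hs ht st; have := FG s t hs ht st; rewrite ler_norml; lra.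
Qed.

(** The expectations decrease with the box and are bounded below by the value of [F] at the field
    that is -1 everywhere. *)
Lemma cvg_fv_exp_incr F : incr F -> cvgn (fun L => fv L F).
Proof.
move=> iF; apply: nonincreasing_is_cvgn.
  by apply/nonincreasing_seqP => L; exact: fv_exp_decr.
exists (F (fun=> -1)) => _ [L _ <-].
rewrite -[leLHS](fv_exp_cst L); apply: ler_fv_exp => s.
apply: iF => z; rewrite ?normrN ?normr1 ?spin_le1//.
by have := spin_le1 s z; rewrite ler_norml => /andP[].
Qed.

Lemma cvg_fv_exp F G : dom F G -> cvgn (fun L => fv L F).
Proof.
move=> FG.
have -> : (fun L => fv L F) =
   (fun L => fv L (fun tau => G tau + F tau) + (-1) * fv L G).
  apply/funext => L; rewrite -fv_expZ -fv_expD; apply: eq_fv_exp => s; ring.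
apply: is_cvgD; first exact/cvg_fv_exp_incr/dom_incrD.
by apply: is_cvgM; [exact: is_cvg_cst|]; exact/cvg_fv_exp_incr/(dom_incr FG).
Qed.

End FV.
End FiniteVolume.

(** * Infinite-volume covariances *)

Section InfiniteVolume.
Context {R : realType}.
Implicit Types (F G : (site -> R) -> R) (tau : site -> R) (p q : site -> R).

(** A class of observables that is closed under sums and products and on which the infinite-volume
    limit exists. Boundedness is what makes products of dominated functions dominated. *)
Definition regular F :=
  (exists k, forall tau, bounded_field tau -> `|F tau| <= k) /\
  (exists G, dom F G).

Lemma regular_cst k : regular (fun=> k).
Proof.
split; first by exists `|k|.
by exists (fun=> 0) => s t _ _ _; rewrite !subrr normr0.
Qed.

Lemma regular_spin z : regular (fun tau => tau z).
Proof.
split; first by exists 1 => tau; exact.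
by exists (fun tau => tau z) => s t _ _ st; rewrite ger0_norm // subr_ge0.
Qed.

Lemma regularD F G : regular F -> regular G ->
  regular (fun tau => F tau + G tau).
Proof.
move=> [[k hk] [F' hF]] [[l hl] [G' hG]]; split.
  exists (k + l) => tau ht; apply: le_trans (ler_normD _ _) _.
  by rewrite lerD ?hk ?hl.
exists (fun tau => F' tau + G' tau) => s t hs ht st.
rewrite !opprD addrACA [leRHS]addrACA; apply: le_trans (ler_normD _ _) _.
by rewrite lerD ?hF ?hG.
Qed.

Lemma regularM F G : regular F -> regular G ->
  regular (fun tau => F tau * G tau).
Proof.
move=> [[k hk] [F' hF]] [[l hl] [G' hG]]; split.
  by exists (k * l) => tau ht; rewrite normrM ler_pM ?hk ?hl.
(* The product rule for increments, with [k] and [l] bounding F and G, yields this dominating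
   function. *)
exists (fun tau => l * F' tau + k * G' tau) => s t hs ht st.
have -> : F t * G t - F s * G s = (F t - F s) * G t + F s * (G t - G s) by ring.
have -> : l * F' t + k * G' t - (l * F' s + k * G' s) =
  (F' t - F' s) * l + k * (G' t - G' s) by ring.
by apply: le_trans (ler_normD _ _) _; rewrite !normrM lerD // ler_pM ?hF ?hG ?hk ?hl.
Qed.

Lemma regularZ k F : regular F -> regular (fun tau => k * F tau).
Proof. by apply: regularM; exact: regular_cst. Qed.

Lemma regular_sum (S : seq site) (F : site -> (site -> R) -> R) :
  (forall z, regular (F z)) -> regular (fun tau => \sum_(z <- S) F z tau).
Proof.
move=> rF; elim: S => [|z S IH].
  under eq_fun do rewrite big_nil; exact: regular_cst.
by under eq_fun do rewrite big_cons; exact: regularD.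
Qed.

Definition linform (S : seq site) p tau := \sum_(z <- S) p z * tau z.

Lemma regular_linform S p : regular (linform S p).
Proof. by apply: regular_sum => z; exact/regularZ/regular_spin. Qed.

Section Measure.
Variables (beta H : R).
Hypothesis beta0 : 0 <= beta.
Local Notation fv := (fv_exp beta H).
Local Notation iv := (iv_exp beta H).

Lemma cvg_regular F : regular F -> cvgn (fun L => fv L F).
Proof. by case=> _ [G]; exact: cvg_fv_exp. Qed.

Lemma eq_iv_exp F G : (forall tau, F tau = G tau) -> iv F = iv G.
Proof. by move=> /funext ->. Qed.

Lemma iv_expD F G : regular F -> regular G ->
  iv (fun tau => F tau + G tau) = iv F + iv G.
Proof.
move=> /cvg_regular cF /cvg_regular cG; rewrite /iv_exp -limD //.
by congr (lim (_ @ \oo)); apply/funext => L; rewrite fv_expD.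
Qed.

Lemma iv_expZ k F : regular F -> iv (fun tau => k * F tau) = k * iv F.
Proof.
move=> /cvg_regular cF; apply/cvg_lim => //.
under eq_fun do rewrite fv_expZ.
by apply: cvgM; [exact: cvg_cst|exact: cF].
Qed.

Lemma iv_exp_cst k : iv (fun=> k) = k.
Proof.
by apply/cvg_lim => //; under eq_fun do rewrite fv_exp_cst; exact: cvg_cst.
Qed.

Lemma iv_exp_sum (S : seq site) (F : site -> (site -> R) -> R) :
  (forall z, regular (F z)) ->
  iv (fun tau => \sum_(z <- S) F z tau) = \sum_(z <- S) iv (F z).
Proof.
move=> rF; elim: S => [|z S IH].
  by under eq_iv_exp do rewrite big_nil; rewrite iv_exp_cst big_nil.
under eq_iv_exp do rewrite big_cons.
by rewrite iv_expD ?IH ?big_cons //; exact: regular_sum.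
Qed.

Definition iv_cov F G := iv (fun tau => F tau * G tau) - iv F * iv G.

Lemma iv_covC F G : iv_cov F G = iv_cov G F.
Proof. by rewrite /iv_cov mulrC; under eq_iv_exp do rewrite mulrC. Qed.

Lemma iv_covD F F' G : regular F -> regular F' -> regular G ->
  iv_cov (fun tau => F tau + F' tau) G = iv_cov F G + iv_cov F' G.
Proof.
move=> rF rF' rG; rewrite /iv_cov; under eq_iv_exp do rewrite mulrDl.
rewrite !iv_expD//; try exact: regularM.
by ring.
Qed.

Lemma iv_covZ k F G : regular F -> regular G ->
  iv_cov (fun tau => k * F tau) G = k * iv_cov F G.
Proof.
move=> rF rG; rewrite /iv_cov; under eq_iv_exp do rewrite -mulrA.
rewrite !iv_expZ//; last exact: regularM.
by ring.
Qed.

Lemma iv_cov_sum (S : seq site) (F : site -> (site -> R) -> R) G :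
  (forall z, regular (F z)) -> regular G ->
  iv_cov (fun tau => \sum_(z <- S) F z tau) G = \sum_(z <- S) iv_cov (F z) G.
Proof.
move=> rF rG; rewrite /iv_cov; under eq_iv_exp do rewrite mulr_suml.
rewrite !iv_exp_sum // => [|z]; last exact: regularM.
by rewrite mulr_suml sumrB.
Qed.

Lemma iv_cov_linform S p q :
  iv_cov (linform S p) (linform S q) =
  \sum_(z <- S) \sum_(w <- S)
    p z * q w * iv_cov (fun tau => tau z) (fun tau => tau w).
Proof.
have rs := regular_spin; have rl := regular_linform S.
rewrite iv_cov_sum //; last by move=> z; exact: regularZ.
apply: eq_bigr => z _; rewrite iv_covZ // iv_covC iv_cov_sum //; last first.
  by move=> w; exact: regularZ.
rewrite mulr_sumr; apply: eq_bigr => w _.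
by rewrite iv_covZ // iv_covC mulrA.
Qed.

(** Positive association holds in each box by [fv_fkg] and passes to the limit. *)
Lemma iv_cov_ge0 F G : regular F -> regular G -> incr F -> incr G ->
  0 <= iv_cov F G.
Proof.
move=> rF rG iF iG; have cF := cvg_regular rF; have cG := cvg_regular rG.
have cFG := cvg_regular (regularM rF rG).
rewrite subr_ge0 /iv_exp -limM //; apply: ler_lim => //; first exact: is_cvgM.
by apply: nearW => L; exact: fv_fkg.
Qed.

(* Polarisation: apply positive association to F' + F, G' - G and to
   F' - F, G' + G, respectively to F' + F, G' + G and to F' - F, G' - G. *)
Lemma iv_cov_dom F F' G G' : regular F -> regular F' -> regular G ->
  regular G' -> dom F F' -> dom G G' -> `|iv_cov F G| <= iv_cov F' G'.
Proof.
move=> rF rF' rG rG' dF dG.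
have key k l (e : k ^+ 2 = 1) (e' : l ^+ 2 = 1) :
    0 <= iv_cov F' G' + k * iv_cov F G' + l * iv_cov F' G + k * l * iv_cov F G.
  have inc (r : R) A A' : r ^+ 2 = 1 -> dom A A' -> incr (fun tau => A' tau + r * A tau).
    move=> r2 dA; have /orP[/eqP ->|/eqP ->] : (r == 1) || (r == -1).
    - by rewrite -eqf_sqr r2 expr1n.
    - by under eq_fun do rewrite mul1r; exact: dom_incrD.
    - by under eq_fun do rewrite mulN1r; exact: dom_incrB.
  have rFk := regularZ k rF; have rGl := regularZ l rG.
  have := iv_cov_ge0 (regularD rF' rFk) (regularD rG' rGl) (inc _ _ _ e dF) (inc _ _ _ e' dG).
  rewrite iv_covD //; last exact: regularD.
  rewrite iv_covZ //; last exact: regularD.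
  rewrite 2!(iv_covC _ (fun tau => _ + _)) !iv_covD // !iv_covZ //.
  rewrite !(iv_covC G) !(iv_covC G').
  by congr (0 <= _); ring.
have one : (1 : R) ^+ 2 = 1 by rewrite expr1n.
have mone : (-1 : R) ^+ 2 = 1 by rewrite sqrrN expr1n.
have := key _ _ one one; have := key _ _ mone mone.
have := key _ _ one mone; have := key _ _ mone one.
by rewrite ler_norml; lra.
Qed.

Definition clamp (K x : R) := Num.max (- K) (Num.min x K).

Lemma clamp_le K x : 0 <= K -> `|clamp K x| <= K.
Proof.
move=> K0; rewrite /clamp ler_norml /Num.min /Num.max.
by case: (ltP x K) => ?; case: ltP => ?; lra.
Qed.

Lemma clamp_lip K x y : 0 <= K -> `|clamp K x - clamp K y| <= `|x - y|.
Proof.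
move=> K0; rewrite ler_norml /clamp /Num.min /Num.max.
have := ler_norm (x - y); have := ler_norm (y - x).
rewrite (distrC y); move: `|x - y| => d h1 h2.
by case: (ltP x K) => ?; case: ltP => ?; case: (ltP y K) => ?; case: ltP => ?; lra.
Qed.

(** Truncation is 1-Lipschitz, and along ordered fields each term changes by at most |p z| times a
    nonnegative spin increment. *)
Lemma dom_clamp_linform K S p : 0 <= K ->
  dom (fun tau => clamp K (linform S p tau)) (linform S (fun z => `|p z|)).
Proof.
move=> K0 s t hs ht st; apply: (le_trans (clamp_lip _ _ K0)).
rewrite /linform -!sumrB; apply: le_trans (ler_norm_sum _ _ _) _.
apply: ler_sum => z _; rewrite -!mulrBr normrM ler_wpM2l //.
by rewrite ger0_norm // subr_ge0.
Qed.

Lemma regular_clamp_linform K S p : 0 <= K ->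
  regular (fun tau => clamp K (linform S p tau)).
Proof.
move=> K0; split; first by exists K => tau _; exact: clamp_le.
by eexists; exact: dom_clamp_linform.
Qed.

(** Domination replaces the truncated forms by untruncated ones with coefficients |p| and |q|, so
    the bound is free of [K]. *)
Lemma iv_cov_clamp K S p q : 0 <= K ->
  `|iv_cov (fun tau => clamp K (linform S p tau))
           (fun tau => clamp K (linform S q tau))| <=
  \sum_(z <- S) \sum_(w <- S)
    `|p z| * `|q w| * iv_cov (fun tau => tau z) (fun tau => tau w).
Proof.
move=> K0; rewrite -(iv_cov_linform S (fun z => `|p z|) (fun z => `|q z|)).
by apply: iv_cov_dom; try exact: regular_linform;
  try exact: regular_clamp_linform; exact: dom_clamp_linform.
Qed.

Lemma iv_cov_diag z : iv_cov (fun tau => tau z) (fun tau => tau z) <= 1.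
Proof.
rewrite /iv_cov [X in X - _](_ : _ = 1).
  by rewrite gerBl -expr2 sqr_ge0.
apply/cvg_lim => //; apply: cvg_near_cst; apply: nearW => L.
rewrite -[RHS](fv_exp_cst beta H L); apply: eq_fv_exp => s; exact: spin_sqr.
Qed.

End Measure.
End InfiniteVolume.

(** * The covariance bound at positive mesh *)

Section Lattice.
Context {R : realType}.
Implicit Types (f g : R * R -> R).

Definition kernel (m : R) f g (x y : R * R) : R :=
  `|f x| * `|g y| * powR (eucl x y) (- (1 / 4)) * expR (- m * eucl x y).

Definition supported_in (r : nat) f :=
  forall x, f x != 0 -> `|x.1| <= r%:R /\ `|x.2| <= r%:R.

Lemma kernel_ge0 m f g x y : 0 <= kernel m f g x y.
Proof. by rewrite /kernel !mulr_ge0 ?powR_ge0 ?expR_ge0. Qed.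

Lemma beta_c_ge0 : 0 <= beta_c R.
Proof. by rewrite mulr_ge0 // ln_ge0 // lerDl sqrtr_ge0. Qed.

(** The sums over growing boxes are constant once the box contains the one outside which f vanishes,
    so their limit is a finite linear form. *)
Lemma latt_fieldE a f N : (forall z, ~~ inbox N z -> f (latt a z) = 0) ->
  forall s, latt_field a f s =
    linform (sites N) (fun z => powR a (15 / 8) * f (latt a z)) s.
Proof.
move=> fN s; apply/cvg_lim => //; apply: cvg_near_cst; near=> K.
have NK : (N <= K)%N by near: K; exact: nbhs_infty_ge.
rewrite pair_big /= (eq_bigr (fun b : box K => s (pos b) * f (latt a (pos b)))) //.
rewrite (sum_box K (fun z => s z * f (latt a z))) /linform mulr_sumr.
rewrite -(sum_sites_le _ NK) (bigID (inbox N)) /= [X in _ + X]big1 ?addr0.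
  by apply: eq_bigr => z _; rewrite mulrAC mulrA.
by move=> z /fN ->; rewrite !mulr0.
Unshelve. all: by end_near. Qed.

Lemma size_sites L : size (sites L) = ((2 * L + 1) ^ 2)%N.
Proof. by rewrite size_map -cardT card_prod card_ord. Qed.

Lemma supported_inbox r f n : supported_in r f ->
  forall z, ~~ inbox (r * n.+1) z -> f (latt n.+1%:R^-1 z) = 0.
Proof.
move=> rf z; apply: contraNeq => /rf /= [].
have P x : `|n.+1%:R^-1 * x%:~R| <= r%:R :> R -> `|x| <= (r * n.+1)%:Z.
  rewrite normrM normfV [`|n.+1%:R|]ger0_norm // ler_pdivrMl // mulrC -natrM.
  by rewrite -intr_norm pmulrn ler_int.
by move=> /P h1 /P h2; apply/andP.
Qed.

Variables (h c m : R).
Hypothesis c0 : 0 < c.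
Hypothesis trunc2_le : forall a : R, 0 < a <= 1 -> forall z w : site, z != w ->
  trunc2 a h z w <=
    c * powR a (1 / 4) * powR (eucl (latt a z) (latt a w)) (- (1 / 4))
      * expR (- m * eucl (latt a z) (latt a w)).

(** Off the diagonal, the two field normalisations and the lattice bound contribute 15/8 + 15/8 +
    1/4 = 4 powers of a, the volume of a pair of cells. On the diagonal there are at most 9 r^2
    a^(-2) sites, each contributing at most a^(15/4) M, in total O(a^(7/4)), which is O(a). *)
Lemma latt_cov_le (K M : R) r f g n (a := n.+1%:R^-1 : R) : 0 <= K ->
  (0 < r)%N -> supported_in r f -> supported_in r g ->
  (forall x, `|f x| * `|g x| <= M) ->
  `| ising_exp a h (fun s => clamp K (latt_field a f s) * clamp K (latt_field a g s))
     - ising_exp a h (fun s => clamp K (latt_field a f s))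
       * ising_exp a h (fun s => clamp K (latt_field a g s)) | <=
  c * (\sum_(z <- sites (r * n.+1)) \sum_(w <- sites (r * n.+1))
        a ^+ 4 * kernel m f g (latt a z) (latt a w))
  + a * (9 * r%:R ^+ 2 * M).
Proof.
move=> K0 r0 rf rg fgM; have a0 : 0 < a by rewrite invr_gt0.
have a1 : a <= 1 by rewrite invf_le1 // ler1n.
set S := sites _.
have -> : latt_field a f = linform S (fun z => powR a (15 / 8) * f (latt a z)).
  by apply/funext => s; rewrite (latt_fieldE (supported_inbox rf)).
have -> : latt_field a g = linform S (fun z => powR a (15 / 8) * g (latt a z)).
  by apply/funext => s; rewrite (latt_fieldE (supported_inbox rg)).
apply: le_trans (iv_cov_clamp _ beta_c_ge0 _ _ _ K0) _.
have pa0 : 0 <= powR a (15 / 8) by exact: powR_ge0.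
have pa : powR a (15 / 8) * powR a (15 / 8) = powR a (15 / 4).
  by rewrite -powRD; [congr powR; lra | apply/implyP => _; rewrite gt_eqF].
(* The lattice bound is only available for distinct sites; on the diagonal the variance of a spin is
   at most 1. *)
have tr z w : iv_cov (beta_c R) (powR a (15 / 8) * h) (fun tau => tau z) (fun tau => tau w)
    <= c * powR a (1 / 4) * (powR (eucl (latt a z) (latt a w)) (- (1 / 4))
       * expR (- m * eucl (latt a z) (latt a w))) + (z == w)%:R.
  case: eqVneq => [<-|zw]; last by rewrite addr0 mulrA; apply: trunc2_le; rewrite ?a0.
  apply: le_trans (iv_cov_diag _ _ _) _; rewrite lerDr.
  by rewrite !mulr_ge0 ?powR_ge0 ?expR_ge0 // ltW.
apply: (@le_trans _ _ (\sum_(z <- S) \sum_(w <- S)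
   (c * (a ^+ 4 * kernel m f g (latt a z) (latt a w)) +
    (z == w)%:R * (powR a (15 / 4) * M)))).
  apply: ler_sum => z _; apply: ler_sum => w _.
  have h0 : 0 <= `|powR a (15 / 8) * f (latt a z)| * `|powR a (15 / 8) * g (latt a w)|.
    by rewrite mulr_ge0.
  apply: le_trans (ler_wpM2l h0 (tr z w)) _.
  rewrite !normrM (ger0_norm pa0) mulrDr lerD //.
    rewrite -(powR_mulrn 4 (ltW a0)).
    have -> : powR a 4%:R = powR a (15 / 8) * powR a (15 / 8) * powR a (1 / 4).
      rewrite pa -powRD; first by congr powR; lra.
      by apply/implyP => _; rewrite gt_eqF.
    rewrite /kernel le_eqVlt; apply/orP; left; apply/eqP; ring.
  case: eqVneq => [<-|_]; last by rewrite mulr0 mul0r.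
  rewrite mulr1 mul1r mulrACA pa ler_wpM2l //; exact: powR_ge0.
under eq_bigr do rewrite big_split/= -mulr_sumr.
rewrite big_split/= -mulr_sumr lerD2l.
rewrite big_seq (eq_bigr (fun=> powR a (15 / 4) * M)); last first.
  move=> z zS; rewrite (bigD1_seq z) ?uniq_sites //= eqxx mul1r big1 ?addr0 //.
  by move=> w; rewrite eq_sym => /negbTE ->; rewrite mul0r.
rewrite -big_seq big_const_seq count_predT iter_addr_0 size_sites -[leLHS]mulr_natl.
have M0 : 0 <= M by apply: le_trans (fgM 0); rewrite mulr_ge0.
rewrite [leRHS]mulrA [leLHS]mulrA; apply: ler_wpM2r => //.
have -> : powR a (15 / 4) = a ^+ 2 * powR a (7 / 4).
  rewrite -(powR_mulrn 2 (ltW a0)) -powRD; first by congr powR; lra.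
  by apply/implyP => _; rewrite gt_eqF.
rewrite [leRHS]mulrC mulrA; apply: ler_pM; rewrite ?mulr_ge0 ?powR_ge0 ?exprn_ge0 ?(ltW a0) //; last first.
  by rewrite -[leRHS](powRr1 (ltW a0)); apply: ger_powR; rewrite ?a0 //; lra.
rewrite natrX -exprMn (_ : 9 * r%:R ^+ 2 = (3 * r%:R) ^+ 2); last by ring.
rewrite lerXn2r ?nnegrE ?mulr_ge0 ?(ltW a0) //.
(* The side of the box has 2 r (n + 1) + 1 <= 3 r (n + 1) sites because r >= 1. *)
rewrite ler_pdivrMr // -!natrM ler_nat; nia.
Qed.

End Lattice.

(** * Riemann sums of the singular kernel *)

Section Snap.
Context {R : realType}.
Implicit Types (f g : R * R -> R) (x y : R * R) (n : nat).

Definition cell n x : site :=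
  (Num.floor (n.+1%:R * x.1), Num.floor (n.+1%:R * x.2)).
(** The lower left corner of the mesh cell containing [x]; composing with [snap] turns lattice sums
    into integrals of step functions. *)
Definition snap n x : R * R := latt n.+1%:R^-1 (cell n x).

Lemma snap1_close n (u : R) :
  u - n.+1%:R^-1 <= n.+1%:R^-1 * (Num.floor (n.+1%:R * u))%:~R <= u.
Proof.
have /andP[h1 h2] := floor_itv (n.+1%:R * u).
rewrite ler_pdivrMl // h1 andbT -(ler_pM2l (x := n.+1%:R)) // mulrA divff // mul1r.
by rewrite mulrBr divff // lerBlDr; apply: ltW; rewrite intrD in h2.
Qed.

Lemma cvg_snap1 (u : R) :
  n.+1%:R^-1 * (Num.floor (n.+1%:R * u))%:~R @[n --> \oo] --> u.
Proof.
apply: (@squeeze_cvgr _ _ _ _ (fun n => u - n.+1%:R^-1) (fun=> u)).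
- by apply: nearW => n; exact: snap1_close.
- rewrite -[X in _ --> X]subr0; apply: cvgB; first exact: cvg_cst.
  exact: cvg_harmonic.
- exact: cvg_cst.
Qed.

Lemma cvg_snap x : snap n x @[n --> \oo] --> x.
Proof. by case: x => u v; exact: (cvg_pair (@cvg_snap1 u) (@cvg_snap1 v)). Qed.

Lemma eucl_ge0 x y : 0 <= eucl x y. Proof. exact: sqrtr_ge0. Qed.

Lemma eucl_ge1 x y : `|x.1 - y.1| <= eucl x y.
Proof. by rewrite -sqrtr_sqr ler_sqrt ?addr_ge0 ?sqr_ge0// lerDl sqr_ge0. Qed.

Lemma eucl_ge2 x y : `|x.2 - y.2| <= eucl x y.
Proof. by rewrite -sqrtr_sqr ler_sqrt ?addr_ge0 ?sqr_ge0// lerDr sqr_ge0. Qed.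

Lemma eucl_gt0 x y : x != y -> 0 < eucl x y.
Proof.
move=> xy; rewrite lt_def eucl_ge0 andbT; apply: contra xy => /eqP e.
have := eucl_ge1 x y; have := eucl_ge2 x y; rewrite e !normr_le0 !subr_eq0.
by move=> /eqP e2 /eqP e1; rewrite (surjective_pairing x) e1 e2 -surjective_pairing.
Qed.

Lemma eucl_latt_ge n (z w : site) : z != w ->
  n.+1%:R^-1 <= eucl (latt n.+1%:R^-1 z) (latt n.+1%:R^-1 w) :> R.
Proof.
have P (i j : int) : i != j ->
    (n.+1%:R^-1 <= `|n.+1%:R^-1 * i%:~R - n.+1%:R^-1 * j%:~R| :> R)%R.
  move=> ij; rewrite -mulrBr normrM ger0_norm ?invr_ge0 // ler_peMr ?invr_ge0 //.
  by rewrite -intrB -intr_norm ler1z; lia.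
case: z w => z1 z2 [w1 w2]; rewrite xpair_eqE negb_and => /orP[] /P h.
- exact: le_trans h (eucl_ge1 (latt _ (z1, z2)) (latt _ (w1, w2))).
- exact: le_trans h (eucl_ge2 (latt _ (z1, z2)) (latt _ (w1, w2))).
Qed.

(** Rounding changes a coordinate difference by at most one mesh width, and distinct lattice points
    are at least one mesh width apart. *)
Lemma snap_dist n x y : snap n x != snap n y ->
  `|x.1 - y.1| <= 2 * eucl (snap n x) (snap n y).
Proof.
move=> xy; have zw : cell n x != cell n y.
  by apply: contra xy; rewrite /snap => /eqP ->.
have h1 := eucl_latt_ge n zw; have h2 := eucl_ge1 (snap n x) (snap n y).
have := snap1_close n x.1; have := snap1_close n y.1.
move: h1 h2; rewrite -!/(snap n _) /= ler_norml.
move: (eucl _ _) (n.+1%:R^-1) => e a.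
move: (a * _) (a * _) => p q h1 /andP[h2 h3] /andP[h4 h5] /andP[h6 h7].
by rewrite ler_norml; apply/andP; split; lra.
Qed.

(* [powR 0 (- (1 / 4)) = 0], so the diagonal does not contribute. *)
Lemma kernel_diag (m : R) f g x : kernel m f g x x = 0.
Proof.
by rewrite /kernel /eucl !subrr expr0n /= addr0 sqrtr0 powR0 ?mulr0 ?mul0r //; lra.
Qed.

(** Off the diagonal every factor is continuous; on it both sides vanish, since equal points are
    rounded to equal points. *)
Lemma cvg_kernel (m : R) f g x y : continuous f -> continuous g ->
  kernel m f g (snap n x) (snap n y) @[n --> \oo] --> kernel m f g x y.
Proof.
move=> cf cg; have [<-|xy] := eqVneq x y.
  by under eq_fun do rewrite kernel_diag; rewrite kernel_diag; exact: cvg_cst.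
have ce : eucl (snap n x) (snap n y) @[n --> \oo] --> eucl x y.
  rewrite /eucl; apply: continuous_cvg; first exact: sqrt_continuous.
  by apply: cvgD; apply: (@cvgM _ _ \oo); apply: cvgB; exact: cvg_snap1.
have e0 := eucl_gt0 xy.
apply: cvgM; [apply: cvgM; [apply: cvgM|]|].
- by apply: cvg_norm; exact: (continuous_cvg _ (cf x) (@cvg_snap x)).
- by apply: cvg_norm; exact: (continuous_cvg _ (cg y) (@cvg_snap y)).
- rewrite powRN; under eq_fun do rewrite powRN.
  apply: cvgV; first by rewrite gt_eqF ?powR_gt0.
  apply: (@continuous_cvg _ _ _ _ _ _ (@powR R ^~ (1 / 4))); last exact: ce.
  apply: differentiable_continuous; apply/derivable1_diffP.
  by apply: derivable_powR; rewrite in_itv /= e0.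
- apply: (@continuous_cvg _ _ _ _ _ _ (@expR R)); first exact: continuous_expR.
  by apply: cvgM; [exact: cvg_cst|exact: ce].
Qed.

Lemma kernel_le (m M : R) f g x y : 0 <= m ->
  (forall x y, `|f x| * `|g y| <= M) ->
  kernel m f g x y <= M * powR (eucl x y) (- (1 / 4)).
Proof.
move=> m0 fgM; rewrite /kernel -[leRHS]mulr1; apply: ler_pM.
- by rewrite !mulr_ge0 ?powR_ge0.
- exact: expR_ge0.
- by apply: ler_wpM2r; rewrite ?powR_ge0.
- by rewrite -expR0 ler_expR mulNr oppr_le0 mulr_ge0 ?eucl_ge0.
Qed.

Lemma supported_snap r f n x : supported_in r f -> f (snap n x) != 0 ->
  `|x.1| <= r.+1%:R /\ `|x.2| <= r.+1%:R.
Proof.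
move=> rf /rf /= [].
have a1 : n.+1%:R^-1 <= 1 :> R by rewrite invf_le1 // ler1n.
have P (u : R) : `|n.+1%:R^-1 * (Num.floor (n.+1%:R * u))%:~R| <= r%:R :> R ->
    `|u| <= r.+1%:R.
  set q := n.+1%:R^-1 * _.
  have /andP[h1 h2] : u - n.+1%:R^-1 <= q <= u := snap1_close n u; clearbody q.
  have -> : r.+1%:R = r%:R + 1 :> R by rewrite natr1.
  rewrite !ler_norml.
  move=> /andP[h3 h4]; apply/andP; move: a1 h1; move: (n.+1%:R^-1) (r%:R) h3 h4 => a b h3 h4 a1 h1.
  by split; lra.
by move=> /P h1 /P h2.
Qed.

(* Here t is the horizontal distance of two points and p the distance of their
   lattice approximations: the kernel singularity is dominated by the geometric
   series of indicators that defines [majorant] below, uniformly in the mesh. *)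
Lemma powR_dyadic (e t p : R) : 2 <= e -> 0 < p -> t <= 2 * p -> t <= e ->
  exists2 k, t <= e / 16 ^+ k & powR p (- (1 / 4)) <= 2 * 2 ^+ k.
Proof.
move=> e2 p0 tp te; have e0 : 0 < e by lra.
have [k0 hk0] : exists k, e / 16 ^+ k.+1 < 2 * p.
  have c0 : geometric e (16^-1 : R) k @[k --> \oo] --> 0.
    by apply: cvg_geometric; rewrite ger0_norm ?invr_ge0 // invf_lt1; lra.
  have p2 : 0 < 2 * p by lra.
  have := cvgr_lt 0 c0 _ p2.
  move=> [K _ hK]; exists K; have := hK K.+1 (leqnSn _).
  by rewrite /= exprVn.
(* For the least such k, minimality gives t <= 2p <= e / 16^k when k > 0, and t <= e covers k =
   0. *)
have [k hk kmin] := ex_minnP (ex_intro (fun k => e / 16 ^+ k.+1 < 2 * p) _ hk0).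
exists k.
  case: k kmin {hk} => [|k] kmin; first by rewrite expr0 divr1.
  apply: le_trans tp _; rewrite leNgt; apply/negP => /kmin; lia.
have q0 : 0 < (2 ^+ k.+1)^-1 :> R by rewrite invr_gt0 exprn_gt0.
(* Since e >= 2, one has 2 / 16^(k+1) <= e / 16^(k+1) < 2p. The ratio 16 = 2^4 is matched to the
   exponent 1/4. *)
have h : ((2 ^+ k.+1)^-1) ^+ 4 <= p.
  have e16 : (2 ^+ k.+1 : R) ^+ 4 = 16 ^+ k.+1.
    by rewrite exprAC; congr (_ ^+ _); ring.
  rewrite exprVn e16 -(ler_pM2l (x := 2)) //; apply/ltW/(le_lt_trans _ hk).
  by rewrite ler_wpM2r // invr_ge0 exprn_ge0.
rewrite powRN -exprS -[leRHS]invrK lef_pV2 ?posrE ?powR_gt0 //.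
have -> : (2 ^+ k.+1)^-1 = powR (((2 ^+ k.+1)^-1) ^+ 4) (1 / 4) :> R.
  rewrite -(powR_mulrn 4 (ltW q0)) -powRrM (_ : 4 * (1 / 4) = 1); last by lra.
  by rewrite powRr1 // ltW.
by apply: ge0_ler_powR; rewrite ?nnegrE ?exprn_ge0 ?(ltW q0) ?(ltW p0) //; lra.
Qed.

End Snap.

(** * Integrals of step functions and an integrable majorant *)

Section Riemann.
Context {R : realType}.
Implicit Types (f g : R * R -> R) (n : nat).

Local Notation leb := (@lebesgue_measure R).
Local Notation mu2 := (leb \x leb)%E.

Lemma lebesgue_itvco (u v : R) : u <= v -> leb `[u, v[%classic = (v - u)%:E.
Proof.
by move=> uv; rewrite lebesgue_measure_itv /= lte_fin; case: ltgtP uv => // -> _;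
  rewrite subrr.
Qed.

Lemma lebesgue_itvcc (u v : R) : u <= v -> leb `[u, v]%classic = (v - u)%:E.
Proof.
by move=> uv; rewrite lebesgue_measure_itv /= lte_fin; case: ltgtP uv => // -> _;
  rewrite subrr.
Qed.

Definition cell1 n (i : int) : set R :=
  `[n.+1%:R^-1 * i%:~R, n.+1%:R^-1 * (i + 1)%:~R[%classic.

Lemma cell1P n i (u : R) : cell1 n i u <-> Num.floor (n.+1%:R * u) = i.
Proof.
rewrite /cell1 /= in_itv /= ler_pdivrMl // ltr_pdivlMl //; split.
  by move=> h; apply: floor_def.
by move=> <-; exact: floor_itv.
Qed.

Definition cell_set n (z : site) : set (R * R) := cell1 n z.1 `*` cell1 n z.2.

Lemma cell_setE n z (x : R * R) : (\1_(cell_set n z) x : R) = (cell n x == z)%:R.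
Proof.
rewrite indicE; congr (_%:R); congr nat_of_bool.
apply/idP/eqP; rewrite in_setE; case: z => i j.
  by move=> [/cell1P h1 /cell1P h2]; rewrite /cell h1 h2.
by move=> [h1 h2]; split; apply/cell1P.
Qed.

Lemma measurable_cell_set n z : measurable (cell_set n z).
Proof. by apply: measurableX; exact: measurable_itv. Qed.

Lemma measure_cell_set n z : mu2 (cell_set n z) = (n.+1%:R^-1 ^+ 2)%:E.
Proof.
rewrite product_measure1E; [|exact: measurable_itv..].
have h i : leb (cell1 n i) = n.+1%:R^-1%:E.
  rewrite lebesgue_itvco; first by rewrite -mulrBr -intrB addrAC subrr add0r mulr1.
  by rewrite ler_wpM2l // ler_int; lia.
by rewrite [X in (X * _)%E]h [X in (_ * X)%E]h.
Qed.

Section Cell.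
Variables (n : nat) (S : seq site) (phi : site -> R).
Hypotheses (uS : uniq S) (phi0 : forall z, 0 <= phi z)
  (phiS : forall z, z \notin S -> phi z = 0).

Let phiE (x : R * R) : ((phi (cell n x))%:E =
  \sum_(z <- S) ((phi z)%:E * (\1_(cell_set n z) x)%:E))%E.
Proof.
under eq_bigr do rewrite -EFinM cell_setE.
rewrite sumEFin; congr EFin.
have [xS|xS] := boolP (cell n x \in S).
  rewrite (bigD1_seq _ xS) //= eqxx mulr1 big1 ?addr0 // => z.
  by rewrite eq_sym => /negbTE ->; rewrite mulr0.
rewrite phiS // big_seq big1 // => z zS; case: eqP => [e|]; last by rewrite mulr0.
by rewrite e zS in xS.
Qed.

Let mterm z : measurable_fun setT
  (fun x : R * R => ((phi z)%:E * (\1_(cell_set n z) x)%:E)%E).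
Proof.
apply: emeasurable_funM; first exact: measurable_cst.
by apply/measurable_EFinP; apply: measurable_indic; exact: measurable_cell_set.
Qed.

Lemma measurable_cell : measurable_fun setT (fun x : R * R => (phi (cell n x))%:E).
Proof.
by under eq_fun do rewrite phiE; apply: emeasurable_sum => z; exact: mterm.
Qed.

(** A function of the cell index that vanishes off the finite list [S] is a finite combination of
    indicators of cells, each of area (n + 1)^(-2). *)
Lemma integral_cell :
  (\int[mu2]_x (phi (cell n x))%:E = (\sum_(z <- S) n.+1%:R^-1 ^+ 2 * phi z)%:E)%E.
Proof.
under eq_integral do rewrite phiE.
rewrite ge0_integral_sum //; last by move=> z x _; rewrite mule_ge0 // lee_fin.
rewrite -sumEFin; apply: eq_bigr => z _.
rewrite ge0_integralZl_EFin //; last first.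
  by apply/measurable_EFinP; apply: measurable_indic; exact: measurable_cell_set.
rewrite integral_indic //; last exact: measurable_cell_set.
by rewrite setIT [X in (_ * X)%E]measure_cell_set -EFinM mulrC.
Qed.

End Cell.

Section Majorant.
Variables (rho : R).
Hypothesis rho1 : 1 <= rho.

(** Only the horizontal width shrinks with k. This suffices: the area is 8 rho^2 / 16^k, so the
    weights 2^k in [majorant] leave a geometric series of ratio 1/8. *)
Definition strip (k : nat) (u : R) : set (R * R) :=
  `[u - 2 * rho / 16 ^+ k, u + 2 * rho / 16 ^+ k]%classic `*` `[- rho, rho]%classic.

Definition majorant (u : R) (y : R * R) : \bar R :=
  (\sum_(0 <= k <oo) (2 ^+ k : R)%:E * (\1_(strip k u) y)%:E)%E.

Lemma measurable_strip k u : measurable (strip k u).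
Proof. by apply: measurableX; exact: measurable_itv. Qed.

Let mterm k u : measurable_fun setT
  (fun y : R * R => ((2 ^+ k : R)%:E * (\1_(strip k u) y)%:E)%E).
Proof.
apply: emeasurable_funM; first exact: measurable_cst.
by apply/measurable_EFinP; apply: measurable_indic; exact: measurable_strip.
Qed.

Let term0 k u y : (0 <= (2 ^+ k : R)%:E * (\1_(strip k u) y)%:E)%E.
Proof. by rewrite -EFinM lee_fin mulr_ge0 // exprn_ge0. Qed.

Lemma majorant_ge0 u y : (0 <= majorant u y)%E.
Proof. by apply: nneseries_ge0 => k _ _; exact: term0. Qed.

Lemma measurable_majorant u : measurable_fun setT (majorant u).
Proof.
apply: (@ge0_emeasurable_sum _ _ _ _ _ xpredT) => [k y _ _|k _].
- exact: term0.
- exact: mterm.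
Qed.

Lemma integral_majorant u : (\int[mu2]_y majorant u y <= (16 * rho ^+ 2)%:E)%E.
Proof.
have rho0 : 0 <= rho by exact: le_trans ler01 rho1.
rewrite integral_nneseries //; last by move=> k; exact: mterm.
have tE k : (\int[mu2]_y ((2 ^+ k : R)%:E * (\1_(strip k u) y)%:E) =
    (8 * rho ^+ 2 * (8^-1) ^+ k)%:E)%E.
  rewrite ge0_integralZl_EFin ?exprn_ge0 //; last first.
    by apply/measurable_EFinP; apply: measurable_indic; exact: measurable_strip.
  rewrite integral_indic //; last exact: measurable_strip.
  rewrite setIT [X in (_ * X)%E]product_measure1E; [|exact: measurable_itv..].
  have q0 : 0 <= 2 * rho / 16 ^+ k by rewrite divr_ge0 ?mulr_ge0 ?exprn_ge0.
  rewrite [X in (_ * (X * _))%E]lebesgue_itvcc; last by lra.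
  rewrite [X in (_ * (_ * X))%E]lebesgue_itvcc; last by lra.
  rewrite -!EFinM; congr EFin.
  have -> : (16 : R) ^+ k = 8 ^+ k * 2 ^+ k by rewrite -exprMn; congr (_ ^+ _); ring.
  by rewrite exprVn; field; rewrite !expf_neq0.
rewrite (eq_eseriesr (fun k _ => tE k)).
apply: lime_le.
  by apply: is_cvg_nneseries => k _ _; rewrite lee_fin mulr_ge0 ?exprn_ge0 // mulr_ge0 ?sqr_ge0.
apply: nearW => N; rewrite sumEFin lee_fin -mulr_sumr.
(* The term 2 / 8^N is slack that lets the induction close; the resulting bound 2 for the series
   accounts for 16 = 8 * 2. *)
suff : \sum_(0 <= k < N) 8^-1 ^+ k <= 2 - 2 * 8^-1 ^+ N :> R.
  have : 0 <= 8^-1 ^+ N :> R by rewrite exprn_ge0.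
  have : 0 <= rho ^+ 2 by rewrite sqr_ge0.
  by move: (\sum_(_ <= _ < _) _) (_ ^+ N) (rho ^+ 2) => s q p; nra.
elim: N => [|N IH]; first by rewrite big_geq // expr0; lra.
rewrite big_nat_recr //= exprS.
have : 0 <= 8^-1 ^+ N :> R by rewrite exprn_ge0.
by lra.
Qed.

Lemma majorant_ge k u y : strip k u y -> ((2 ^+ k : R)%:E <= majorant u y)%E.
Proof.
move=> h; apply: le_trans (nneseries_lim_ge k.+1 _) => [|i _ _]; last exact: term0.
rewrite big_nat_recr //= indicE mem_set // mule1 leeDr //.
by apply: sume_ge0 => i _; exact: term0.
Qed.

End Majorant.
End Riemann.

(** * Convergence of the Riemann sums to the kernel integral *)

Section RiemannKernel.
Context {R : realType}.
Variables (f g : R * R -> R) (m M : R) (r : nat).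
Hypotheses (cf : continuous f) (cg : continuous g) (m0 : 0 <= m)
  (fgM : forall x y, `|f x| * `|g y| <= M)
  (rf : supported_in r f) (rg : supported_in r g).

Local Notation mu2 := (@lebesgue_measure R \x @lebesgue_measure R)%E.
Local Notation rho := (r.+1%:R : R).
Local Notation S n := (sites (r * n.+1)).

Let rho1 : 1 <= rho. Proof. by rewrite ler1n. Qed.
Let M0 : 0 <= M. Proof. by apply: le_trans (fgM 0 0); rewrite mulr_ge0. Qed.

(** If f and g do not vanish at the rounded points, both original points lie within [rho] of the
    axes, so [powR_dyadic] applies with e = 2 [rho] and selects one strip; its constant 2 gives the
    factor 2 M. In all other cases, and when the rounded points coincide, the kernel is zero. *)
Lemma kernel_snap_le n x y :
  ((kernel m f g (snap n x) (snap n y))%:E <= (2 * M)%:E * majorant rho x.1 y)%E.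
Proof.
have triv : kernel m f g (snap n x) (snap n y) = 0 ->
    ((kernel m f g (snap n x) (snap n y))%:E <= (2 * M)%:E * majorant rho x.1 y)%E.
  by move=> ->; rewrite mule_ge0 ?majorant_ge0 // lee_fin mulr_ge0.
have [fx|fx] := eqVneq (f (snap n x)) 0.
  by apply: triv; rewrite /kernel fx normr0 !mul0r.
have [gy|gy] := eqVneq (g (snap n y)) 0.
  by apply: triv; rewrite /kernel gy normr0 mulr0 !mul0r.
have [e|e] := eqVneq (snap n x) (snap n y).
  by apply: triv; rewrite e kernel_diag.
have [x1 _] := supported_snap rf fx; have [y1 y2] := supported_snap rg gy.
have te : `|x.1 - y.1| <= 2 * rho.
  apply: le_trans (ler_normB _ _) _.
  by rewrite mulr2n mulrDl !mul1r lerD.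
have e2 : 2 <= 2 * rho by rewrite ler_peMr.
have [k hk hp] := powR_dyadic e2 (eucl_gt0 e) (snap_dist e) te.
apply: (@le_trans _ _ ((2 * M)%:E * (2 ^+ k)%:E)%E).
  rewrite -EFinM lee_fin; apply: le_trans (kernel_le _ _ m0 fgM) _.
  by rewrite -mulrA mulrCA ler_wpM2l.
rewrite lee_wpmul2l //; first by rewrite lee_fin mulr_ge0.
apply: majorant_ge; split; rewrite /= in_itv /=.
  by move: hk; rewrite ler_norml => /andP[h1 h2]; apply/andP; split; lra.
by move: y2; rewrite ler_norml.
Qed.

Lemma kernel_off n x w : w \notin S n -> kernel m f g x (latt n.+1%:R^-1 w) = 0.
Proof.
rewrite mem_sites => /(supported_inbox rg) h.
by rewrite /kernel h normr0 mulr0 !mul0r.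
Qed.

Let inner n x : (\int[mu2]_y (kernel m f g (snap n x) (snap n y))%:E =
  (\sum_(w <- S n) n.+1%:R^-1 ^+ 2 * kernel m f g (snap n x) (latt n.+1%:R^-1 w))%:E)%E.
Proof.
apply: (@integral_cell _ _ _
  (fun w => kernel m f g (snap n x) (latt n.+1%:R^-1 w)) (uniq_sites (r * n.+1))) => [w|w]; first exact: kernel_ge0.
exact: kernel_off.
Qed.

Lemma integrable_majorant u : mu2.-integrable setT (majorant rho u).
Proof.
apply/integrableP; split; first exact: measurable_majorant.
under eq_integral do rewrite gee0_abs ?majorant_ge0 //.
exact: le_lt_trans (integral_majorant rho1 u) (ltry _).
Qed.

Lemma cvg_inner x :
  (\int[mu2]_y (kernel m f g (snap n x) (snap n y))%:E)%E @[n --> \oo] -->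
  (\int[mu2]_y (kernel m f g x y)%:E)%E.
Proof.
have mF n : measurable_fun setT
    (fun y : R * R => (kernel m f g (snap n x) (snap n y))%:E).
  apply: (@measurable_cell _ _ _
      (fun w => kernel m f g (snap n x) (latt n.+1%:R^-1 w)) (uniq_sites (r * n.+1))) => w;
      exact: kernel_off.
have cF y : (kernel m f g (snap n x) (snap n y))%:E @[n --> \oo] -->
    (kernel m f g x y)%:E.
  by apply: cvg_EFin; [exact: nearW|exact: cvg_kernel].
have [] // := @dominated_convergence _ _ _ mu2 setT measurableT
  (fun n y => (kernel m f g (snap n x) (snap n y))%:E)
  (fun y => (kernel m f g x y)%:E)
  (fun y => (2 * M)%:E * majorant rho x.1 y)%E mF.
- by apply: emeasurable_fun_cvg mF _ => y _; exact: cF.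
- by apply: aeW => y _; exact: cF.
- by apply: integrableZl => //; exact: integrable_majorant.
- apply: aeW => y n _; rewrite gee0_abs ?lee_fin ?kernel_ge0 //.
  exact: kernel_snap_le.
Qed.

(** The double sum is the iterated integral of the kernel at rounded points. Dominated convergence
    is used twice: in y under the majorant ([cvg_inner]), then in x under a constant multiple of the
    indicator of a square. *)
Lemma riemann_kernel :
  let I := (\int[mu2]_x \int[mu2]_y (kernel m f g x y)%:E)%E in
  I \is a fin_num /\
  \sum_(z <- S n) \sum_(w <- S n) n.+1%:R^-1 ^+ 4 *
    kernel m f g (latt n.+1%:R^-1 z) (latt n.+1%:R^-1 w) @[n --> \oo] --> fine I.
Proof.
pose phi n z := \sum_(w <- S n) n.+1%:R^-1 ^+ 2 *
  kernel m f g (latt n.+1%:R^-1 z) (latt n.+1%:R^-1 w).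
pose B := (`[- rho, rho]%classic `*` `[- rho, rho]%classic : set (R * R)).
have mB : measurable B by apply: measurableX; exact: measurable_itv.
have innerE n x : (\int[mu2]_y (kernel m f g (snap n x) (snap n y))%:E =
  (phi n (cell n x))%:E)%E by exact: inner.
have phi0 n z : 0 <= phi n z.
  by apply: sumr_ge0 => w _; rewrite mulr_ge0 ?kernel_ge0 ?exprn_ge0 ?invr_ge0.
have phiS n z : z \notin S n -> phi n z = 0.
  rewrite mem_sites => /(supported_inbox rf) h; rewrite /phi big1 // => w _.
  by rewrite /kernel h normr0 !mul0r mulr0.
have mF n : measurable_fun setT (fun x : R * R => (phi n (cell n x))%:E).
  exact: (@measurable_cell _ n _ (phi n) (uniq_sites (r * n.+1)) (@phiS n)).
have cF x : (phi n (cell n x))%:E @[n --> \oo] -->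
    (\int[mu2]_y (kernel m f g x y)%:E)%E.
  by under eq_fun do rewrite -innerE; exact: cvg_inner.
(* The integral of the majorant is bounded uniformly in its centre, which makes the outer bound a
   constant; it is supported in the square because f vanishes at rounded points of any x outside. *)
have bF n x : (`|(phi n (cell n x))%:E| <=
    (2 * M * (16 * rho ^+ 2))%:E * (\1_B x)%:E)%E.
  rewrite gee0_abs; last by rewrite lee_fin.
  have [fx|fx] := eqVneq (f (snap n x)) 0.
    rewrite [phi _ _](_ : _ = 0); first by rewrite -EFinM lee_fin !mulr_ge0 ?sqr_ge0.
    rewrite /phi big1 // => w _; rewrite -/(snap n x).
    by rewrite /kernel fx normr0 !mul0r mulr0.
  have [x1 x2] := supported_snap rf fx.
  rewrite indicE mem_set; last by split; rewrite /= in_itv /= -ler_norml.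
  rewrite /= mule1 -innerE EFinM.
  apply: (@le_trans _ _ (\int[mu2]_y ((2 * M)%:E * majorant rho x.1 y))%E).
    apply: ge0_le_integral => //.
    - by move=> y _; rewrite lee_fin kernel_ge0.
    - apply: (@measurable_cell _ _ _
      (fun w => kernel m f g (snap n x) (latt n.+1%:R^-1 w)) (uniq_sites (r * n.+1))) => w;
      exact: kernel_off.
    - by apply: emeasurable_funM; [exact: measurable_cst|exact: measurable_majorant].
    - by move=> y _; exact: kernel_snap_le.
  rewrite ge0_integralZl_EFin ?mulr_ge0 //; last 2 first.
  - by move=> y _; exact: majorant_ge0.
  - exact: measurable_majorant.
  by rewrite lee_wpmul2l ?lee_fin ?mulr_ge0 //; exact: integral_majorant.
have [] := @dominated_convergence _ _ _ mu2 setT measurableT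
  (fun n x => (phi n (cell n x))%:E)
  (fun x => \int[mu2]_y (kernel m f g x y)%:E)%E
  (fun x => (2 * M * (16 * rho ^+ 2))%:E * (\1_B x)%:E)%E mF.
- by apply: emeasurable_fun_cvg mF _ => x _; exact: cF.
- by apply: aeW => x _; exact: cF.
- apply: integrableZl => //; apply/integrableP; split.
    by apply/measurable_EFinP; exact: measurable_indic.
  under eq_integral do rewrite gee0_abs ?lee_fin //.
  rewrite integral_indic // setIT [X in (X < _)%E]product_measure1E; [|exact: measurable_itv..].
  have rr : - rho <= rho by rewrite (@le_trans _ _ 0) // oppr_le0.
  have h := lebesgue_itvcc rr.
  by rewrite [X in (X * _)%E]h [X in (_ * X)%E]h -EFinM ltry.
- by apply: aeW => x n _; exact: bF.
move=> iI _ cI I; have fI : I \is a fin_num by exact: integrable_fin_num.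
split=> //; move: cI; rewrite -/I -(fineK fI) => cI.
suff E n : (\int[mu2]_x (phi n (cell n x))%:E = (\sum_(z <- S n) \sum_(w <- S n)
    n.+1%:R^-1 ^+ 4 * kernel m f g (latt n.+1%:R^-1 z) (latt n.+1%:R^-1 w))%:E)%E.
  by move: cI; under eq_fun do rewrite E; move=> /fine_cvg.
rewrite (@integral_cell _ n _ (phi n) (uniq_sites (r * n.+1)) (@phi0 n) (@phiS n)).
congr EFin; apply: eq_bigr => z _; rewrite mulr_sumr; apply: eq_bigr => w _.
by rewrite mulrA -exprD.
Qed.

End RiemannKernel.

(** * Covariance as a limit of truncated covariances *)

Section Clamp.
Context {R : realType}.
Implicit Types (K x : R).

Lemma clamp_id K x : `|x| <= K -> clamp K x = x.
Proof.
rewrite ler_norml => /andP[h1 h2]; rewrite /clamp /Num.min /Num.max.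
by case: (ltP x K) => ?; case: ltP => ?; lra.
Qed.

Lemma clamp_le_norm K x : 0 <= K -> `|clamp K x| <= `|x|.
Proof.
move=> K0; have := clamp_lip x 0 K0; rewrite (@clamp_id K 0) ?normr0 //.
by rewrite !subr0.
Qed.

Lemma clamp_top K x : 0 <= K -> K <= x -> clamp K x = K.
Proof.
move=> K0 Kx; rewrite /clamp /Num.min /Num.max.
by case: (ltP x K) => ?; case: ltP => ?; lra.
Qed.

Lemma clamp_bottom K x : 0 <= K -> x <= - K -> clamp K x = - K.
Proof.
move=> K0 Kx; rewrite /clamp /Num.min /Num.max.
by case: (ltP x K) => ?; case: ltP => ?; lra.
Qed.

(** Together with [clamp_le_norm] this makes |clamp K x| nondecreasing in K, as monotone convergence
    requires. *)
Lemma clamp_clamp K L x : 0 <= K -> K <= L -> clamp K (clamp L x) = clamp K x.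
Proof.
move=> K0 KL; have L0 := le_trans K0 KL.
have [xL|Lx] := leP `|x| L; first by rewrite (clamp_id xL).
have /orP[h|h] : (L <= x) || (x <= - L).
  by move: Lx; rewrite lter_normr => /orP[] h; apply/orP; [left|right]; lra.
- by rewrite (clamp_top L0 h) !clamp_top //; lra.
- by rewrite (clamp_bottom L0 h) !clamp_bottom //; lra.
Qed.

Lemma cvg_clamp x : clamp n%:R x @[n --> \oo] --> x.
Proof.
apply: cvg_near_cst; near=> n; apply: clamp_id.
by near: n; exact: nbhs_infty_ger.
Unshelve. all: by end_near. Qed.

Lemma continuous_clamp K : continuous (clamp K).
Proof.
move=> x; apply: (@continuous_max _ _ (fun=> - K) (Num.min^~ K)).
  exact: cvg_cst.
by apply: (@continuous_min _ _ id (fun=> K)); [exact: cvg_id|exact: cvg_cst].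
Qed.

End Clamp.

(** * From bounds on truncated covariances to the covariance itself *)

Section ClampedCovariance.
Context {d : measure_display} {Omega : measurableType d} {R : realType}.
Variable P : probability Omega R.
Implicit Types (F G X Y : Omega -> R).

Local Notation Ex F := (\int[P]_w (F w))%R.
Local Notation intg F := (P.-integrable setT (EFin \o (F))).

Lemma integrable_bounded F k : measurable_fun setT F -> (forall w, `|F w| <= k) ->
  intg F.
Proof.
move=> mF Fk.
apply: (le_integrable measurableT _ _ (finite_measure_integrable_cst P k measurableT)).
  exact/measurable_EFinP.
by move=> w _ /=; rewrite lee_fin (le_trans (Fk w)) // ler_norm.
Qed.

Lemma Ex_cst (k : R) : Ex (fun=> k) = k.
Proof. by rewrite Rintegral_cst // [X in fine X]probability_setT mulr1. Qed.

Lemma cvg_Ex (F : nat -> Omega -> R) F0 G :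
  (forall n, measurable_fun setT (F n)) -> measurable_fun setT F0 -> intg G ->
  (forall w, F n w @[n --> \oo] --> F0 w) -> (forall n w, `|F n w| <= G w) ->
  Ex (F n) @[n --> \oo] --> Ex F0.
Proof.
move=> mF mF0 iG cF FG.
have [|||||iF0 _ c] := @dominated_convergence _ _ _ P setT measurableT
  (fun n => EFin \o F n) (EFin \o F0) (EFin \o G) => //.
- by move=> n; exact/measurable_EFinP.
- exact/measurable_EFinP.
- by apply: aeW => w _; apply: cvg_EFin; [exact: nearW|exact: cF].
- by apply: aeW => w n _; rewrite /= lee_fin.
rewrite /Rintegral; apply: fine_cvg; rewrite fineK ?integrable_fin_num //.
Qed.

Lemma measurable_clamp K X : measurable_fun setT X ->
  measurable_fun setT (fun w => clamp K (X w)).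
Proof.
move=> mX; apply: measurable_maxr; first exact: measurable_cst.
by apply: measurable_minr => //; exact: measurable_cst.
Qed.

Section SecondMoment.
Variables (X : Omega -> R) (b : R).
Hypotheses (mX : measurable_fun setT X)
  (vX : forall K, 0 <= K -> Ex (fun w => clamp K (X w) * clamp K (X w))
     - Ex (fun w => clamp K (X w)) * Ex (fun w => clamp K (X w)) <= b).

Let mT K : measurable_fun setT (fun w => clamp K (X w)).
Proof. exact: measurable_clamp. Qed.

Let iT K : 0 <= K -> intg (fun w => clamp K (X w)).
Proof. by move=> K0; apply: (integrable_bounded (k := K)) => // w; exact: clamp_le. Qed.

Let iTT K : 0 <= K -> intg (fun w => clamp K (X w) * clamp K (X w)).
Proof.
move=> K0; apply: (integrable_bounded (k := K * K)) => [|w].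
  exact: measurable_funM.
by rewrite normrM ler_pM // clamp_le.
Qed.

(* On an event |X| <= N of probability at least 1/2, the inequality
   B^2 / 2 - N^2 <= (clamp K X - B)^2 with B = E (clamp K X) bounds the mean B
   by the variance. *)
Lemma clamp_second_moment :
  exists C, forall K, 0 <= K -> Ex (fun w => clamp K (X w) * clamp K (X w)) <= C.
Proof.
pose A n := setT `&` X @^-1` `[- n%:R, n%:R]%classic.
have mA n : measurable (A n) by apply: mX => //; exact: measurable_itv.
have AP n w : A n w <-> `|X w| <= n%:R.
  by rewrite /A /= in_itv /= -ler_norml; split => [[]|].
have : Ex (fun w => \1_(A n) w) @[n --> \oo] --> Ex (fun=> 1 : R).
  apply: (cvg_Ex (G := fun=> 1)) => [n| | |w|n w].
  - exact: measurable_indic.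
  - exact: measurable_cst.
  - exact: finite_measure_integrable_cst.
  - apply: cvg_near_cst; near=> n; rewrite indicE mem_set //.
    by apply/AP; near: n; exact: nbhs_infty_ger.
  - by rewrite indicE; case: (_ \in _); rewrite ?normr0 ?normr1.
rewrite Ex_cst => /cvgr_gt /(_ (2^-1)); rewrite invf_lt1 ?ltr1n // => /(_ isT).
move=> [N _ /(_ N (leqnn N))]; set p := Ex _ => /= p2.
(* The second moment V is at most b + B^2, and B^2 <= 4b + 2N^2 is shown below. *)
exists (5 * b + 2 * N%:R ^+ 2) => K K0.
set V := Ex (fun w => clamp K (X w) * clamp K (X w)); set B := Ex (fun w => clamp K (X w)).
have vb : V - B * B <= b by exact: vX.
have iA : intg (\1_(A N)).
  by apply: (integrable_bounded (k := 1)) => [|w];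
    [exact: measurable_indic|rewrite indicE; case: (_ \in _); rewrite ?normr0 ?normr1].
have iB (q : R) : intg (fun w => q * clamp K (X w)).
  exact: (integrableZl measurableT _ (iT K0)).
have E1 : Ex (fun w => clamp K (X w) * clamp K (X w) - 2 * B * clamp K (X w) + B * B)
    = V - B * B.
  rewrite RintegralD //; last 2 first.
  - exact: (integrableB measurableT (iTT K0) (iB _)).
  - exact: finite_measure_integrable_cst.
  rewrite RintegralB //; last exact: iTT.
  rewrite RintegralZl //; last exact: iT.
  by rewrite -/V -/B Ex_cst; ring.
have E2 : (B ^+ 2 / 2 - N%:R ^+ 2) * p <= V - B * B.
  rewrite -E1 -RintegralZl //; apply: le_Rintegral => //.
  - exact: (integrableZl measurableT _ iA).
  - exact: (integrableD measurableT (integrableB measurableT (iTT K0) (iB _))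
      (finite_measure_integrable_cst P (B * B) measurableT)).
  move=> w _; have sq : clamp K (X w) * clamp K (X w) - 2 * B * clamp K (X w) + B * B
    = (clamp K (X w) - B) ^+ 2 by ring.
  (* On the event, with T = clamp K X and T^2 <= N^2, the claim follows from (2T - B)^2 >= 0; off
     the event the left side is 0. *)
  rewrite sq indicE; case: (boolP (w \in A N)) => [|_].
    rewrite in_setE => /AP h; rewrite mulr1.
    have : clamp K (X w) ^+ 2 <= N%:R ^+ 2.
      rewrite -[leLHS]real_normK ?num_real // lerXn2r ?nnegrE //.
      exact: le_trans (clamp_le_norm _ K0) h.
    have : 0 <= (2 * clamp K (X w) - B) ^+ 2 by exact: sqr_ge0.
    by move: (clamp K (X w)) (N%:R : R) => t q; rewrite !expr2; lra.
  by rewrite mulr0 sqr_ge0.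
have VB : 0 <= V - B * B.
  rewrite -E1; apply: Rintegral_ge0 => // w _.
  have -> : clamp K (X w) * clamp K (X w) - 2 * B * clamp K (X w) + B * B
    = (clamp K (X w) - B) ^+ 2 by ring.
  exact: sqr_ge0.
have N2 : 0 <= N%:R ^+ 2 :> R by exact: sqr_ge0.
have b0 : 0 <= b by exact: le_trans vb.
(* Otherwise B^2 / 2 - N^2 > 2b, and a probability above 1/2 would push the truncated variance
   beyond b. *)
have : B * B <= 4 * b + 2 * N%:R ^+ 2.
  rewrite leNgt; apply/negP => h.
  have h1 : 2 * b < B ^+ 2 / 2 - N%:R ^+ 2 by rewrite expr2; lra.
  have : 2^-1 * (B ^+ 2 / 2 - N%:R ^+ 2) <= p * (B ^+ 2 / 2 - N%:R ^+ 2).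
    by rewrite ler_wpM2r ?(ltW p2) //; lra.
  by lra.
by lra.
Unshelve. all: by end_near. Qed.

(** The squares of the truncations increase to X^2 and have bounded expectations, so monotone
    convergence applies. *)
Lemma integrable_square : intg (fun w => X w * X w).
Proof.
have [C hC] := clamp_second_moment.
have mXX : measurable_fun setT (fun w => X w * X w) by exact: measurable_funM.
apply/integrableP; split; first exact/measurable_EFinP.
under eq_integral do rewrite gee0_abs ?lee_fin -?expr2 ?sqr_ge0 //.
pose F (n : nat) w := (clamp n%:R (X w) * clamp n%:R (X w))%:E.
have F0 n w : (0 <= F n w)%E by rewrite lee_fin -expr2 sqr_ge0.
have mF n : measurable_fun setT (F n).
  by apply/measurable_EFinP; apply: measurable_funM; exact: mT.
have ndF w : {homo F^~ w : n k / (n <= k)%N >-> (n <= k)%E}.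
  move=> n k nk; rewrite lee_fin -!expr2 -[leLHS]real_normK ?num_real //.
  rewrite -[leRHS]real_normK ?num_real // lerXn2r ?nnegrE //.
  by rewrite -(@clamp_clamp _ n%:R k%:R) ?ler_nat // clamp_le_norm.
have := @cvg_monotone_convergence _ _ _ P setT measurableT F mF
  (fun n w _ => F0 n w) (fun w _ => ndF w).
have -> : (\int[P]_w limn (F^~ w) = \int[P]_w (X w ^+ 2)%:E)%E.
  apply: eq_integral => w _; apply/cvg_lim => //.
  apply: cvg_EFin; first exact: nearW.
  by rewrite expr2; apply: (@cvgM _ _ \oo); exact: cvg_clamp.
move=> c; apply: (@le_lt_trans _ _ C%:E); last exact: ltry.
apply: (cvge_to_le c); apply: nearW => n.
have := hC n%:R (ler0n _ n).
rewrite -lee_fin /Rintegral fineK //.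
by apply: integrable_fin_num => //; exact: iTT.
Qed.

End SecondMoment.

Lemma integrable_of_square X : measurable_fun setT X ->
  intg (fun w => X w * X w) -> intg X.
Proof.
move=> mX iX.
have i1 : intg (fun w => X w * X w + 1).
  exact: (integrableD measurableT iX (finite_measure_integrable_cst P 1 measurableT)).
apply: (le_integrable measurableT _ _ i1); first exact/measurable_EFinP.
move=> w _ /=; rewrite lee_fin [leRHS]ger0_norm; last first.
  by rewrite addr_ge0 // -expr2 sqr_ge0.
rewrite -[X w * X w]expr2 -real_normK ?num_real //.
have : 0 <= (`|X w| - 1) ^+ 2 by exact: sqr_ge0.
have : 0 <= `|X w| by [].
by rewrite !expr2; lra.
Qed.

Lemma integrable_mul X Y : measurable_fun setT X -> measurable_fun setT Y ->
  intg (fun w => X w * X w) -> intg (fun w => Y w * Y w) ->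
  intg (fun w => `|X w| * `|Y w|).
Proof.
move=> mX mY iX iY.
have i1 : intg (fun w => X w * X w + Y w * Y w) by exact: (integrableD measurableT iX iY).
apply: (le_integrable measurableT _ _ i1).
  apply/measurable_EFinP; apply: measurable_funM; exact: measurableT_comp.
move=> w _ /=; rewrite lee_fin [leRHS]ger0_norm; last first.
  by rewrite addr_ge0 // -expr2 sqr_ge0.
rewrite -!expr2 -(real_normK (num_real (X w))) -(real_normK (num_real (Y w))).
rewrite [leLHS]ger0_norm ?mulr_ge0 //.
have : 0 <= (`|X w| - `|Y w|) ^+ 2 by exact: sqr_ge0.
have : 0 <= `|X w| * `|Y w| by exact: mulr_ge0.
by rewrite !expr2; lra.
Qed.

(** The variance bounds [bX] and [bY] put X and Y in L^2 and do not enter the conclusion. Then |X|,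
    |Y| and |X| |Y| are integrable majorants for the truncated expectations. *)
Lemma covariance_clamp_le (X Y : {RV P >-> R}) (bX bY b : R) :
  (forall K, 0 <= K -> Ex (fun w => clamp K (X w) * clamp K (X w))
     - Ex (fun w => clamp K (X w)) * Ex (fun w => clamp K (X w)) <= bX) ->
  (forall K, 0 <= K -> Ex (fun w => clamp K (Y w) * clamp K (Y w))
     - Ex (fun w => clamp K (Y w)) * Ex (fun w => clamp K (Y w)) <= bY) ->
  (forall K, 0 <= K -> `|Ex (fun w => clamp K (X w) * clamp K (Y w))
     - Ex (fun w => clamp K (X w)) * Ex (fun w => clamp K (Y w))| <= b) ->
  (`|covariance P X Y| <= b%:E)%E.
Proof.
move=> hX hY hXY.
have mX : measurable_fun setT X by exact: measurable_funPT.
have mY : measurable_fun setT Y by exact: measurable_funPT.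
have iXX := integrable_square mX hX; have iYY := integrable_square mY hY.
have iX := integrable_of_square mX iXX; have iY := integrable_of_square mY iYY.
have iM := integrable_mul mX mY iXX iYY.
have mXY : measurable_fun setT (fun w => X w * Y w) by exact: measurable_funM.
have iXY : intg (fun w => X w * Y w).
  apply: (le_integrable measurableT _ _ iM); first exact/measurable_EFinP.
  by move=> w _ /=; rewrite lee_fin !normrM !normr_id.
have iabs F : intg F -> intg (fun w => `|F w|) by exact: integrable_abse.
have n0 (n : nat) : 0 <= n%:R :> R by exact: ler0n.
rewrite covarianceE; [|exact/Lfun1_integrable..].
have EE F : intg F -> ('E_P[F] = (Ex F)%:E)%E.
  by move=> iF; rewrite unlock /Rintegral fineK // integrable_fin_num.
rewrite !EE // -EFinM -EFinB lee_fin.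
have cX : Ex (fun w => clamp n%:R (X w)) @[n --> \oo] --> Ex X.
  apply: (cvg_Ex (G := fun w => `|X w|)) => // [n| |w|n w].
  - exact: measurable_clamp.
  - exact: iabs.
  - exact: cvg_clamp.
  - exact: clamp_le_norm.
have cY : Ex (fun w => clamp n%:R (Y w)) @[n --> \oo] --> Ex Y.
  apply: (cvg_Ex (G := fun w => `|Y w|)) => // [n| |w|n w].
  - exact: measurable_clamp.
  - exact: iabs.
  - exact: cvg_clamp.
  - exact: clamp_le_norm.
have cXY : Ex (fun w => clamp n%:R (X w) * clamp n%:R (Y w)) @[n --> \oo] -->
    Ex (fun w => X w * Y w).
  apply: (cvg_Ex (G := fun w => `|X w| * `|Y w|)) => // [n|w|n w].
  - by apply: measurable_funM; exact: measurable_clamp.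
  - by apply: (@cvgM _ _ \oo); exact: cvg_clamp.
  - by rewrite normrM ler_pM // clamp_le_norm.
have c : `|Ex (fun w => clamp n%:R (X w) * clamp n%:R (Y w)) -
    Ex (fun w => clamp n%:R (X w)) * Ex (fun w => clamp n%:R (Y w))| @[n --> \oo] -->
    `|Ex (fun w => X w * Y w) - Ex X * Ex Y|.
  by apply: cvg_norm; apply: cvgB => //; exact: cvgM.
change (`|Ex (fun w => X w * Y w) - Ex X * Ex Y| <= b).
have cb : (fun=> b) @ \oo --> b by exact: cvg_cst.
by apply: ler_cvg_to c cb _; apply: nearW => n; exact: hXY.
Qed.

End ClampedCovariance.

(** * Passage to the scaling limit *)

Section TestFunctions.
Context {R : realType}.
Implicit Types f : R * R -> R.

Lemma testfun_continuous f : testfun f -> continuous f.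
Proof. by case=> /(_ [::])[]. Qed.

(** Stated for all large radii so that two test functions can share one. *)
Lemma testfun_supported f : testfun f ->
  exists r0, forall r, (r0 <= r)%N -> supported_in r f.
Proof.
move=> [_ [K [cK fK]]]; have /pinfty_ex_gt0[B B0 hB] := compact_bounded cK.
exists (Num.trunc B).+1 => r hr x fx.
have Kx : K x by apply: contrapT => /fK e; rewrite e eqxx in fx.
have Br : B <= r%:R by apply/ltW/(lt_le_trans (truncnS_gt B)); rewrite ler_nat.
have := le_trans (hB x Kx) Br; rewrite /Num.norm /= ge_max.
by move=> /andP[].
Qed.

Lemma testfun_bounded f : testfun f -> exists M, forall x, `|f x| <= M.
Proof.
move=> tf; have [_ [K [cK fK]]] := tf; have cf := testfun_continuous tf.
have /pinfty_ex_gt0[B B0 hB] :=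
  compact_bounded (continuous_compact (continuous_subspaceT cf) cK).
exists B => x; case: (pselect (K x)) => [Kx|/fK ->]; last by rewrite normr0 ltW.
by apply: hB; exists x.
Qed.

End TestFunctions.

(** * The limit of vanishing mesh *)

Section ScalingLimit.
Context {R : realType} {d : measure_display} {Omega : measurableType d}.
Variables (h c m : R) (P : probability Omega R)
  (Phi : (R * R -> R) -> {RV P >-> R}).
Hypotheses (c0 : 0 < c) (m0 : 0 < m)
  (trunc2_le : forall a : R, 0 < a <= 1 -> forall z w : site, z != w ->
     trunc2 a h z w <=
       c * powR a (1 / 4) * powR (eucl (latt a z) (latt a w)) (- (1 / 4))
         * expR (- m * eucl (latt a z) (latt a w)))
  (cvg_Phi : forall f g : R * R -> R, testfun f -> testfun g ->
     forall F : R * R -> R, continuous F -> (exists M : R, forall x, `|F x| <= M) ->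
     (fun a : R => (ising_exp a h (fun s => F (latt_field a f s, latt_field a g s)))%:E)
       @ 0^'+ --> ('E_P[fun w => F (Phi f w, Phi g w)])%E).

Local Notation mu2 := (@lebesgue_measure R \x @lebesgue_measure R)%E.
Local Notation I f g := (\int[mu2]_x \int[mu2]_y (kernel m f g x y)%:E)%E.

(** Convergence in law is sampled along the meshes 1 / (n + 1) of the Riemann sums. *)
Lemma cvg_Phi_harmonic f g (F : R * R -> R) (M : R) : testfun f -> testfun g -> continuous F ->
  (forall x, `|F x| <= M) ->
  measurable_fun setT (fun w => F (Phi f w, Phi g w)) ->
  ising_exp n.+1%:R^-1 h
    (fun s => F (latt_field n.+1%:R^-1 f s, latt_field n.+1%:R^-1 g s)) @[n --> \oo]
  --> \int[P]_w F (Phi f w, Phi g w).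
Proof.
move=> tf tg cF FM mF.
have := cvg_Phi tf tg cF (ex_intro _ M FM).
have iF := integrable_bounded P mF (fun w => FM _).
rewrite unlock -[X in _ --> X]fineK; last exact: integrable_fin_num.
move=> /cvge_at_rightP /(_ (fun n => n.+1%:R^-1)) H.
by apply: (fine_cvg (H _)); split; [move=> n; rewrite invr_gt0|exact: cvg_harmonic].
Qed.

(** The lattice inequality [latt_cov_le] is passed to the limit: the left side converges in law
    since truncation is bounded and continuous, the sum converges by [riemann_kernel], and the
    diagonal term vanishes with the mesh. *)
Lemma clamped_covariance_le f g K : testfun f -> testfun g -> 0 <= K ->
  I f g \is a fin_num /\
  `| \int[P]_w (clamp K (Phi f w) * clamp K (Phi g w))
     - \int[P]_w (clamp K (Phi f w)) * \int[P]_w (clamp K (Phi g w)) |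
  <= c * fine (I f g).
Proof.
move=> tf tg K0.
have [rf hrf] := testfun_supported tf; have [rg hrg] := testfun_supported tg.
have [Mf hMf] := testfun_bounded tf; have [Mg hMg] := testfun_bounded tg.
pose r := (rf + rg).+1.
have sf : supported_in r f by apply: hrf; rewrite /r; lia.
have sg : supported_in r g by apply: hrg; rewrite /r; lia.
have fgM x y : `|f x| * `|g y| <= Mf * Mg by rewrite ler_pM.
have [fI cI] := riemann_kernel (testfun_continuous tf) (testfun_continuous tg)
  (ltW m0) fgM sf sg.
split=> //.
have c1 : continuous (fun p : R * R => clamp K p.1).
  by move=> p; apply: continuous_comp; [exact: cvg_fst|exact: continuous_clamp].
have c2 : continuous (fun p : R * R => clamp K p.2).
  by move=> p; apply: continuous_comp; [exact: cvg_snd|exact: continuous_clamp].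
have c12 : continuous (fun p : R * R => clamp K p.1 * clamp K p.2).
  by move=> p; apply: cvgM; [exact: c1|exact: c2].
have m1 := measurable_clamp K (measurable_funPT (Phi f)).
have m2 := measurable_clamp K (measurable_funPT (Phi g)).
have l1 := cvg_Phi_harmonic tf tg c1 (fun p => clamp_le p.1 K0) m1.
have l2 := cvg_Phi_harmonic tf tg c2 (fun p => clamp_le p.2 K0) m2.
have K2 (p : R * R) : `|clamp K p.1 * clamp K p.2| <= K * K.
  by rewrite normrM ler_pM // clamp_le.
have l12 := cvg_Phi_harmonic tf tg c12 K2 (measurable_funM m1 m2).
have l := cvg_norm (cvgB l12 (cvgM l1 l2)).
have lS := cvgD (cvgM (cvg_cst c) cI)
  (cvgM (@cvg_harmonic R) (cvg_cst (9 * r%:R ^+ 2 * (Mf * Mg)))).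
rewrite mul0r addr0 in lS.
apply: ler_cvg_to (l _ _ _) (lS _ _ _ _ _) _.
apply: nearW => n.
exact: (latt_cov_le c0 trunc2_le n K0 (ltn0Sn _) sf sg (fun x => fgM x x)).
Qed.

Lemma covariance_Phi_le f g : testfun f -> testfun g ->
  (`| covariance P (Phi f) (Phi g) | <= c%:E * I f g)%E.
Proof.
(* The truncation level 0 serves only to extract the finiteness of the integral. *)
move=> tf tg; have [fI _] := clamped_covariance_le tf tg (lexx 0).
rewrite -(fineK fI) -EFinM.
(* The two variance bounds are the cases f = g of the truncated estimate. *)
apply: (covariance_clamp_le (bX := c * fine (I f f)) (bY := c * fine (I g g))) => K K0.
- exact: le_trans (ler_norm _) (clamped_covariance_le tf tf K0).2.
- exact: le_trans (ler_norm _) (clamped_covariance_le tg tg K0).2.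
- exact: (clamped_covariance_le tf tg K0).2.
Qed.

End ScalingLimit.

Unset Implicit Arguments.

Theorem theorem2 (R : realType) (h c m : R)
  (d : measure_display) (Omega : measurableType d) (P : probability Omega R)
  (Phi : (R * R -> R) -> {RV P >-> R}) :
  0 < h -> 0 < c -> 0 < m ->
  (* the lattice bound defining c(h), m(h) *)
  (forall a : R, 0 < a <= 1 -> forall z w : site, z != w ->
     trunc2 a h z w <=
       c * powR a (1 / 4) * powR (eucl (latt a z) (latt a w)) (- (1 / 4))
         * expR (- m * eucl (latt a z) (latt a w))) ->
  (* Phi is the scaling limit in law of Phi^{a,h} as a -> 0+
     (convergence of the joint laws of (Phi(f), Phi(g))) *)
  (forall f g : R * R -> R, testfun f -> testfun g ->
     forall F : R * R -> R, continuous F -> (exists M : R, forall x, `|F x| <= M) ->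
     (fun a : R => (ising_exp a h (fun s => F (latt_field a f s, latt_field a g s)))%:E)
       @ 0^'+ --> ('E_P[fun w => F (Phi f w, Phi g w)])%E) ->
  forall f g : R * R -> R, testfun f -> testfun g ->
    (`| covariance P (Phi f) (Phi g) |
     <= c%:E * \int[(@lebesgue_measure R \x @lebesgue_measure R)%E]_x
                 \int[(@lebesgue_measure R \x @lebesgue_measure R)%E]_y
                   (`|f x| * `|g y| * powR (eucl x y) (- (1 / 4))
                      * expR (- m * eucl x y))%:E)%E.
Proof.
move=> _ c0 m0 trunc2_le cvg_Phi f g tf tg.
exact: (covariance_Phi_le c0 m0 trunc2_le cvg_Phi tf tg).
Qed.
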